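(* There is an absolute constant $c>0$ such that the following holds. Let $H$ be a graph and let $g\geq 2$ be an integer that is an integral power of $2$. Let $A,B,X$ be three disjoint sets of vertices of $H$, each of cardinality $\kappa\geq 2^{22}g^9\log g$, such that every vertex of $X$ has degree $1$ in $H$. Assume that there is a set $\tilde{\mathcal{P}}$ of $\kappa$ node-disjoint paths connecting vertices of $A$ to vertices of $B$ in $H$, and a set $\tilde{\mathcal{Q}}$ of $\kappa$ node-disjoint paths connecting vertices of $A$ to vertices of $X$ in $H$ (paths of $\tilde{\mathcal P}$ and of $\tilde{\mathcal Q}$ need not be disjoint from each other). Then either $H$ contains an $(A,B,X)$-crossbar of width $g^2$, or there is a minor $H'$ of $H$ that contains a strong Path-of-Sets System of length at least $cg^2$ and width at least $cg^2$.
   Context: Logarithms are base 2. An $(A,B,X)$-crossbar of width $\rho$ in $H$ consists of a set $\mathcal{P}^*$ of $\rho$ paths, each connecting a vertex of $A$ to a vertex of $B$, and for each $P\in\mathcal{P}^*$ a path $Q_P$ connecting a vertex of $P$ to a vertex of $X$, such that the paths of $\mathcal{P}^*$ are pairwise vertex-disjoint, the paths of $\mathcal{Q}^*=\{Q_P\}$ are pairwise vertex-disjoint, and for $P\in\mathcal{P}^*$, $Q\in\mathcal{Q}^*$: if $Q\ne Q_P$ then $P\cap Q=\emptyset$, and otherwise $P\cap Q$ is a single vertex which is an endpoint of $Q_P$. A vertex set $T$ is node-well-linked in $C$ if for all disjoint $T',T''\subseteq T$ there are $\min(|T'|,|T''|)$ node-disjoint paths in $C$ connecting $T'$ to $T''$;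 disjoint $(A,B)$ are linked in $C$ if for all $A'\subseteq A,B'\subseteq B$ there are $\min(|A'|,|B'|)$ node-disjoint paths in $C$ connecting $A'$ to $B'$. A strong Path-of-Sets System of length $\ell$ and width $w$ consists of mutually vertex-disjoint connected subgraphs $C_1,\ldots,C_\ell$; for each $i$ disjoint $A_i,B_i\subseteq V(C_i)$ of size $w$, each node-well-linked in $C_i$, with $(A_i,B_i)$ linked in $C_i$; and for each $1\le i<\ell$ a set $\mathcal{P}_i$ of $w$ node-disjoint paths connecting $B_i$ to $A_{i+1}$, all paths of $\bigcup_i\mathcal P_i$ node-disjoint and having no inner vertex in $\bigcup_j V(C_j)$. *)

(* Defs.v *)
From HB Require Import structures.
From mathcomp Require Import all_boot all_order all_algebra.
From mathcomp Require Import reals exp.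

Set Implicit Arguments.
Unset Strict Implicit.
Unset Printing Implicit Defensive.

(* Finite simple graphs. The vertex set is a subset of the carrier [V], so that
   a graph and its subgraphs have the same type. *)
Record graph (V : finType) := Graph {
  verts : {set V};
  adj : rel V;
  adj_sym : symmetric adj;
  adj_irrefl : irreflexive adj;
  adj_verts : forall u v, adj u v -> u \in verts
}.

Section Graphs.
Variable V : finType.
Implicit Types (G H C : graph V) (S T A B X : {set V}) (p q : seq V).

Definition degree G (v : V) : nat := #|[set u | adj G v u]|.

Definition subgraph C G : Prop :=
  verts C \subset verts G /\ subrel (adj C) (adj G).

Definition connected G : Prop :=
  verts G != set0 /\ {in verts G &, forall u v, connect (adj G) u v}.

Section Induced.
Variables (G : graph V) (S : {set V}).

Definition induced_adj : rel V :=
  [rel u v | [&& u \in S, v \in S & adj G u v]].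

Fact induced_sym : symmetric induced_adj.
Proof. by move=> u v; rewrite /induced_adj /= adj_sym andbCA. Qed.

Fact induced_irrefl : irreflexive induced_adj.
Proof. by move=> u; rewrite /induced_adj /= adj_irrefl !andbF. Qed.

Fact induced_verts u v : induced_adj u v -> u \in verts G :&: S.
Proof. by case/and3P=> uS _ /adj_verts uG; rewrite inE uG. Qed.

Definition induced : graph V := Graph induced_sym induced_irrefl induced_verts.
End Induced.

(* A path is the nonempty duplicate-free sequence of its vertices; a path
   connecting [A] to [B] is listed from its endpoint in [A] to the one in [B].
   A single vertex is a path. *)
Definition path_between G A B p : bool :=
  if p is x :: s then
    [&& x \in verts G, path (adj G) x s, uniq p, x \in A & last x s \in B]
  else false.

Definition endpoint p (v : V) : bool :=
  if p is x :: s then (v == x) || (v == last x s) else false.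

Definition inner p : seq V := if p is x :: s then behead (belast x s) else [::].

Definition pairwise_disjoint (I : eqType) (P : I -> seq V) : Prop :=
  forall i j, i != j -> [disjoint P i & P j].

Definition disjoint_paths G A B (k : nat) : Prop :=
  exists P : 'I_k -> seq V,
    (forall i, path_between G A B (P i)) /\ pairwise_disjoint P.

Definition node_well_linked C T : Prop :=
  forall T1 T2, T1 \subset T -> T2 \subset T -> [disjoint T1 & T2] ->
    disjoint_paths C T1 T2 (minn #|T1| #|T2|).

Definition linked C A B : Prop :=
  forall A' B', A' \subset A -> B' \subset B ->
    disjoint_paths C A' B' (minn #|A'| #|B'|).

(* [Q i] is the path associated with [P i]. *)
Record is_crossbar H A B X (rho : nat) (P Q : 'I_rho -> seq V) : Prop := {
  crossbar_P : forall i, path_between H A B (P i);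
  crossbar_Q : forall i, path_between H [set v in P i] X (Q i);
  crossbar_disjP : pairwise_disjoint P;
  crossbar_disjQ : pairwise_disjoint Q;
  crossbar_disjPQ : forall i j, i != j -> [disjoint P i & Q j];
  crossbar_meet : forall i, exists2 v,
    endpoint (Q i) v & [set u in P i] :&: [set u in Q i] = [set v]
}.

Definition has_crossbar H A B X (rho : nat) : Prop :=
  exists P Q : 'I_rho -> seq V, is_crossbar H A B X P Q.

(* Clusters are numbered from 0; [P i] is the set of paths from [B i] to
   [A (i + 1)], and [P (l - 1)] is unconstrained. *)
Record is_strong_pos G (l w : nat) (C : 'I_l -> graph V)
    (A B : 'I_l -> {set V}) (P : 'I_l -> 'I_w -> seq V) : Prop := {
  pos_subgraph : forall i, subgraph (C i) G;
  pos_connected : forall i, connected (C i);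
  pos_disjC : forall i j, i != j -> [disjoint verts (C i) & verts (C j)];
  pos_subA : forall i, A i \subset verts (C i);
  pos_subB : forall i, B i \subset verts (C i);
  pos_disjAB : forall i, [disjoint A i & B i];
  pos_cardA : forall i, #|A i| = w;
  pos_cardB : forall i, #|B i| = w;
  pos_wlA : forall i, node_well_linked (C i) (A i);
  pos_wlB : forall i, node_well_linked (C i) (B i);
  pos_linked : forall i, linked (C i) (A i) (B i);
  pos_path : forall i j : 'I_l, j = i.+1 :> nat ->
    forall k, path_between G (B i) (A j) (P i k);
  pos_disjP : forall (i i' : 'I_l) (k k' : 'I_w), i.+1 < l -> i'.+1 < l ->
    (i, k) != (i', k') -> [disjoint P i k & P i' k'];
  pos_inner : forall (i j : 'I_l) (k : 'I_w), i.+1 < l ->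
    [disjoint inner (P i k) & verts (C j)]
}.

Definition has_strong_pos G (l w : nat) : Prop :=
  exists (C : 'I_l -> graph V) (A B : 'I_l -> {set V})
    (P : 'I_l -> 'I_w -> seq V), is_strong_pos G C A B P.
End Graphs.

(* [phi u] is the branch set of the vertex [u] of [G']. *)
Record is_minor_model (U V : finType) (G' : graph U) (G : graph V)
    (phi : U -> {set V}) : Prop := {
  model_sub : {in verts G', forall u, phi u \subset verts G};
  model_connected : {in verts G', forall u, connected (induced G (phi u))};
  model_disj : {in verts G' &, forall u v, u != v -> [disjoint phi u & phi v]};
  model_adj : forall u v, adj G' u v ->
    exists x y, [/\ x \in phi u, y \in phi v & adj G x y]
}.

Definition minor (U V : finType) (G' : graph U) (G : graph V) : Prop :=
  exists phi : U -> {set V}, is_minor_model G' G phi.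

Definition log2 (R : realType) (x : R) : R := (ln x / ln 2)%R.

(* Main.v *)
(** Suppose that there is no crossbar of width [rho = g ^ 2]. Contracting the
    [A]-[B] paths [P i] to single vertices, Menger's theorem yields fewer than
    [rho] of these paths and other vertices that together separate all of the
    paths from [X]; discarding the paths used and repeating gives [K] pairwise
    disjoint layers, each of which separates [X] from a set [U] of [p] heads of the
    remaining paths, while [U] and [X] are joined by [p] disjoint strands [R r].

    Among the minors of [H] that retain this configuration take one with the fewest
    edges. There no edge of a strand can be deleted, so the strands can be swept
    from left to right by frontiers that no edge jumps over, as in a path
    decomposition. Every strand but [rho] meets every layer, so the frontiers can be
    spaced to make the slots between consecutive ones rich in incidences between
    strands and paths. As few paths start inside most slots, these incidences are
    carried by few pieces of paths, and an extremal choice of strands and pieces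
    yields in each such slot a cluster that no small vertex set disconnects.

    Two clusters are joined when [w] disjoint paths lead from the exits of the first
    to the entries of the second between their slots. Among [n] clusters some two
    are joined: fewer than [w] vertices separating two clusters must block every strand
    common to both and every route that changes strands in a third cluster between
    them, and double counting such routes leaves the clusters too few strands.
    Hence there is a long chain of joined clusters, which is the strong
    Path-of-Sets System. All bounds are polynomial in [g], and [c = 1] suffices. *)

Require Import Defs.
From HB Require Import structures.
From Stdlib Require Import Classical.
From mathcomp Require Import all_boot all_order all_algebra.
From mathcomp Require Import reals exp.
From mathcomp Require Import zify.

Set Implicit Arguments.
Unset Strict Implicit.
Unset Printing Implicit Defensive.

(** The resource being spent is the number of incident pairs of a strand and a path. The layers
    supply about [K * p] such pairs on at most [K * rho] paths, so on average a path is met by about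
    [p / rho] strands.

    The obstacle is that a path may cross a slot arbitrarily often; cut into too many pieces, it
    would tie together only few strands in each of them. Two consequences of minimality bound the
    pieces. A path edge with an end off the strands could be contracted, so both ends of every path
    edge lie on strands. No edge jumps over a frontier, so a piece that does not contain the first
    vertex of its path is entered from a vertex of one of the two frontiers around the slot. A slot
    therefore has at most [2 * p] pieces more than paths starting inside it.

    Edges common to a strand and a path can be contracted as well. Hence the edges of strands in a
    minimal instance lie on no path, and deleting one of them can only destroy the linkage; this is
    what forces the strands to be swept in order. *)

Lemma disjointI (T : finType) (p q : seq T) :
  (forall v, v \in p -> v \in q -> False) -> [disjoint p & q].
Proof. by move=> H; apply/pred0P => v; apply/negP => /andP[/H]. Qed.

(** * Menger's theorem *)

Section Menger.
Variable T : finType.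
Implicit Types (e : rel T) (A B X S : {set T}).

Definition avoid e X : rel T := [rel u v | [&& u \notin X, v \notin X & e u v]].

Definition separates e A B X : bool :=
  [forall x in A :\: X, forall y in B :\: X, ~~ connect (avoid e X) x y].

Lemma avoid_path e X x s : x \notin X ->
  path (avoid e X) x s = path e x s && ~~ has [in X] s.
Proof.
elim: s x => [|y s IH] x xX //=; rewrite /avoid /= -/(avoid e X) xX /=.
case: (boolP (y \in X)) => [yX | yX] /=; first by rewrite andbF.
by rewrite IH // andbA.
Qed.

Lemma separatesP e A B X :
  reflect (forall x s, x \in A -> path e x s -> last x s \in B ->
             has [in X] (x :: s))
          (separates e A B X).
Proof.
apply: (iffP idP) => [sepX x s xA xs sB | H].
  apply: contraT; rewrite /= negb_or => /andP[xX sX].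
  move/forall_inP: sepX => /(_ x); rewrite inE xX xA => /(_ isT) /forall_inP.
  move=> /(_ (last x s)); rewrite inE sB andbT.
  have -> /= : last x s \notin X.
    have := mem_last x s; rewrite inE => /predU1P[-> // | ls].
    by apply: contra sX => lX; apply/hasP; exists (last x s).
  by move=> /(_ isT) /negP[]; apply/connectP; exists s; rewrite // avoid_path // xs.
apply/forall_inP => x /setDP[xA xX]; apply/forall_inP => y /setDP[yB yX].
apply/negP => /connectP[s]; rewrite avoid_path // => /andP[xs sX] yl.
by have := H x s xA xs; rewrite -yl => /(_ yB) /=; rewrite (negPf xX) (negPf sX).
Qed.

(** Meeting [A] only at the start and [B] only at the end is used twice: to glue two families of
    paths in the proof of Menger's theorem, and to keep the inner vertices of the paths between
    clusters outside the clusters. *)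
Definition link e A B (p : seq T) : bool :=
  if p is x :: s then
    [&& path e x s, uniq (x :: s), x \in A, last x s \in B,
        all [predC A] s & all [predC B] (belast x s)]
  else false.

Lemma trim_source e A x s : path e x s -> (x \in A) || has [in A] s ->
  exists x' s', [/\ x' \in A, path e x' s', last x' s' = last x s,
    all [predC A] s' & {subset x' :: s' <= x :: s}].
Proof.
elim: s x => [|y s IH] x /=.
  by rewrite orbF => _ xA; exists x, [::]; split.
case/andP=> xy ys; case: (boolP ((y \in A) || has [in A] s)) => [yA _ | nA].
  have [x' [s' [? ? ? ? sub]]] := IH y ys yA.
  by exists x', s'; split=> // z /sub; rewrite !inE => ->; rewrite orbT.
rewrite orbF => xA; exists x, (y :: s); split; rewrite //= ?xy //.
by move: nA; rewrite negb_or -all_predC.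
Qed.

Lemma trim_target e B x s : path e x s -> (x \in B) || has [in B] s ->
  exists s', [/\ path e x s', last x s' \in B,
    all [predC B] (belast x s') & {subset s' <= s}].
Proof.
elim: s x => [|y s IH] x /=; first by rewrite orbF => _ xB; exists [::]; split.
case/andP=> xy ys; case: (boolP (x \in B)) => [xB _ | xB /= yB].
  by exists [::].
have [s' [? ? ? sub]] := IH y ys yB; exists (y :: s').
split=> //=; rewrite ?xy ?xB // => z; rewrite !inE => /predU1P[->|/sub ->] //.
  by rewrite eqxx.
by rewrite orbT.
Qed.

Lemma trim e A B x s : path e x s -> x \in A -> last x s \in B ->
  exists2 p, link e A B p & {subset p <= x :: s}.
Proof.
move=> xs xA sB.
have [|x1 [s1 [x1A p1 l1 a1 sub1]]] := @trim_source e A x s xs; first by rewrite xA.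
have [|s2 [p2 l2 b2 sub2]] := @trim_target e B x1 s1 p1.
  have := mem_last x1 s1; rewrite l1 inE => /orP[/eqP <-|ls]; first by rewrite sB.
  by apply/orP; right; apply/hasP; exists (last x s).
have [s3 [p3 u3 l3 sub3]] : exists s3, [/\ path e x1 s3, uniq (x1 :: s3),
    last x1 s3 = last x1 s2 & {subset s3 <= s2}].
  by case/shortenP: p2 => s3 p3 u3 sub3; exists s3.
have sub32 : {subset x1 :: s3 <= x1 :: s2}.
  by move=> z; rewrite !inE => /predU1P[->|/sub3->]; rewrite ?eqxx ?orbT.
have sub21 : {subset x1 :: s2 <= x1 :: s1}.
  by move=> z; rewrite !inE => /predU1P[->|/sub2->]; rewrite ?eqxx ?orbT.
exists (x1 :: s3); last by move=> z /sub32 /sub21 /sub1.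
rewrite /link p3 u3 x1A l3 l2 /=; apply/andP; split; apply/allP => z zs.
  by apply: (allP a1); apply/sub2/sub3.
have zl : z != last x1 s2.
  by apply: contraTneq u3 => zl; rewrite lastI rcons_uniq l3 -zl zs.
have : z \in x1 :: s2 by apply/sub32/mem_belast.
by rewrite lastI mem_rcons inE (negPf zl) => /(allP b2).
Qed.

Lemma surj_count k (f : 'I_k -> T) S : injective f -> (forall i, f i \in S) ->
  #|S| = k -> forall y, y \in S -> exists i, f i = y.
Proof.
move=> finj fS cS y; have -> : S = f @: 'I_k.
  apply/esym/eqP; rewrite eqEcard card_imset // card_ord cS leqnn andbT.
  by apply/subsetP => _ /imsetP[i _ ->].
by case/imsetP => i _ ->; exists i.
Qed.

Lemma separates_sub e e' A B X : (forall x y, e x y -> x != y -> e' x y) ->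
  separates e' A B X -> separates e A B X.
Proof.
move=> sub /forall_inP H; apply/forall_inP => x xA; apply/forall_inP => y yB.
apply: contra (forall_inP (H x xA) y yB); apply: connect_sub => u v /= /and3P[uX vX uv].
have [->|nuv] := eqVneq u v; first exact: connect0.
by apply: connect1; rewrite /avoid /= uX vX sub.
Qed.

Lemma linkP e A B p : link e A B p ->
  exists x s, [/\ p = x :: s, path e x s, x \in A & last x s \in B] /\
    ({in s, forall z, z \notin A} /\ {in belast x s, forall z, z \notin B}).
Proof.
case: p => // x s /andP[xs /and5P[_ xA sB /allP a /allP b]].
by exists x, s; split.
Qed.

(** Induction on the number of pairs in [e], which need not be symmetric. If deleting a pair
    [(x, y)] creates a separator [S] with fewer than [k] elements, then [x |: S] and [y |: S] both
    have exactly [k] elements, and linkages from [A] to the former and from the latter to [B] are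
    glued along [S] and the pair [(x, y)]. *)
Lemma menger e A B k : (forall X, separates e A B X -> k <= #|X|) ->
  exists P : 'I_k -> seq T, (forall i, link e A B (P i)) /\
    (forall i j, i != j -> [disjoint P i & P j]).
Proof.
have [n] := ubnP #|[set a : T * T | e a.1 a.2]|.
elim: n => // n IH in e A B * => /ltnSE len sepk.
(* Disjoint walks suffice, because each of them contains a link. *)
have weak : (exists P : 'I_k -> seq T, (forall i, exists x s, [/\ P i = x :: s,
    path e x s, x \in A & last x s \in B]) /\
    (forall i j, i != j -> [disjoint P i & P j])) ->
  exists P : 'I_k -> seq T, (forall i, link e A B (P i)) /\
    (forall i j, i != j -> [disjoint P i & P j]).
  case=> P [Pp Pd].
  have Q i : {q | link e A B q && all [in P i] q}.
    apply/sigW; have [x [s [-> xs xA sB]]] := Pp i.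
    by have [q lq sub] := trim xs xA sB; exists q; rewrite lq; apply/allP.
  exists (fun i => sval (Q i)); split=> [i | i j /Pd dij]; first by case: (Q i) => q /= /andP[].
  have QP l : sval (Q l) \subset P l by case: (Q l) => q /= /andP[_ /allP/subsetP].
  exact: disjointWl (QP i) (disjointWr (QP j) dij).
case: (pickP [pred a : T * T | e a.1 a.2 && (a.1 != a.2)]) => [[x y] /= /andP[exy nxy] | none]; last first.
  (* Only loops are left, so [A :&: B] is a separator and one-vertex paths form the linkage. *)
  have kAB : k <= #|A :&: B|.
    apply: sepk; apply/forall_inP => x /setDP[xA xAB]; apply/forall_inP => y /setDP[yB _].
    apply/negP => /connectP[s]; elim: s x xA xAB => [|z s IHs] x xA xAB /=.
      by move=> _ yx; move: xAB; rewrite inE xA -yx yB.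
    case/andP=> /and3P[_ _ xz]; have := none (x, z); rewrite /= xz /=.
    by move/negbT; rewrite negbK => /eqP <-; apply: IHs.
  exists (fun i => [:: enum_val (widen_ord kAB i)]); split=> [i | i j nij].
    have := enum_valP (widen_ord kAB i); rewrite inE => /andP[vA vB].
    by rewrite /link /= vA vB.
  rewrite disjoint_has /= orbF inE (inj_eq enum_val_inj).
  by rewrite -val_eqE /= val_eqE.
pose e' : rel T := [rel u v | e u v && ((u, v) != (x, y))].
have e'e : subrel e' e by move=> u v /andP[].
have le' : #|[set a : T * T | e' a.1 a.2]| < n.
  apply: leq_trans len; apply: proper_card; apply/properP; split.
    by apply/subsetP => a; rewrite !inE => /andP[].
  by exists (x, y); rewrite inE // /e' /= eqxx andbF.
have [kS|] := boolP [forall S : {set T}, separates e' A B S ==> (k <= #|S|)].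
  have [|P [Pl Pd]] := IH e' A B le'; first by move=> X sX; apply: (implyP (forallP kS X)).
  apply: weak; exists P; split=> // i; have [a [s [[-> ps ? ?] _]]] := linkP (Pl i).
  by exists a, s; split=> //; apply: (sub_path e'e).
rewrite negb_forall => /existsP[S]; rewrite negb_imply -ltnNge => /andP[sepS cS].
(* A walk that avoids [S] must use the deleted pair, so it passes through both [x] and [y]. *)
have sepx z : (z == x) || (z == y) -> separates e A B (z |: S).
  move=> zxy; apply/forall_inP => a; rewrite !inE negb_or => /andP[/andP[az aS] aA].
  apply/forall_inP => b; rewrite !inE negb_or => /andP[/andP[bz bS] bB].
  have := forall_inP (forall_inP sepS a _) b; rewrite !inE aS aA bS bB => /(_ isT isT).
  apply: contra; apply: connect_sub => u v; rewrite /avoid /= !inE !negb_or.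
  case/and3P=> /andP[uz uS] /andP[vz vS] uv; apply: connect1; rewrite /e' /= uS vS uv /=.
  by apply: contraTneq zxy => -[<- <-]; rewrite negb_or ![z == _]eq_sym uz vz.
have cz z : (z == x) || (z == y) -> z \notin S /\ #|z |: S| = k.
  move=> /sepx /sepk; rewrite cardsU1; case: (z \in S) => //=; lia.
have [xS cx] : x \notin S /\ #|x |: S| = k by apply: cz; rewrite eqxx.
have [yS cy] : y \notin S /\ #|y |: S| = k by apply: cz; rewrite eqxx orbT.
have [|P1 [P1l P1d]] := IH e' A (x |: S) le'.
  move=> X sX; apply: sepk; apply/separatesP => a s aA as_ sB.
  have /= hx := separatesP _ _ _ _ (sepx x _) a s aA as_ sB.
  have [|s' [ps' ls' bs' sub]] := @trim_target e (x |: S) a s as_; first by apply: hx; rewrite eqxx.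
  have p's' : path e' a s'.
    elim: s' a ps' bs' {as_ hx aA sB ls' sub} => //= v s' IHs a /andP[av vs'].
    rewrite !inE negb_or => /andP[/andP[ax _] bs']; apply/andP; split; last exact: IHs.
    rewrite /e' /= av /=; by apply: contra ax => /eqP[->].
  have /hasP[v vs vX] := separatesP _ _ _ _ sX a s' aA p's' ls'.
  apply/(@hasP _ [in X] (a :: s)); exists v => //; move: vs; rewrite !inE => /predU1P[->|/sub->].
    by rewrite eqxx.
  by rewrite orbT.
have [|P2 [P2l P2d]] := IH e' (y |: S) B le'.
  move=> X sX; apply: sepk; apply/separatesP => a s aA as_ sB.
  have /= hx := separatesP _ _ _ _ (sepx y _) a s aA as_ sB.
  have [|a' [s' [aA' ps' ls' bs' sub]]] := @trim_source e (y |: S) a s as_.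
    by apply: hx; rewrite eqxx orbT.
  have p's' : path e' a' s'.
    elim: s' a' ps' bs' {as_ hx aA sB aA' ls' sub} => //= v s' IHs a' /andP[av vs'].
    rewrite !inE negb_or => /andP[/andP[ax _] bs']; apply/andP; split; last exact: IHs.
    rewrite /e' /= av /=; by apply: contra ax => /eqP[_ ->].
  have /hasP[v vs vX] := separatesP _ _ _ _ sX a' s' aA' p's' (etrans (congr1 _ ls') sB).
  by apply/(@hasP _ [in X] (a :: s)); exists v => //; apply: sub.
(* If the two families met outside [S], a prefix from the first and a suffix from the second would
   form a walk of [e'] that avoids [S]. *)
have cross i j v : v \in P1 i -> v \in P2 j -> [/\ v \in S, v = last v (P1 i) & v = head v (P2 j)].
  have [a [s1 [[-> p1 aA l1] [_ b1]]]] := linkP (P1l i).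
  have [b [s2 [[-> p2 bA l2] [b2 _]]]] := linkP (P2l j).
  move=> v1 v2; have vl : v \in S -> v = last a s1.
    move=> vS; move: v1; rewrite lastI mem_rcons inE => /predU1P[// | /b1].
    by rewrite !inE vS orbT.
  have vh : v \in S -> v = b.
    move=> vS; move: v2; rewrite inE => /predU1P[// | /b2].
    by rewrite !inE vS orbT.
  have vS : v \in S; last by split=> //=; [exact: vl | exact: vh].
  apply: contraT => vS.
  case/splitPl: v1 b1 p1 l1 {vl vh} => q1 r1 lq1; rewrite belast_cat cat_path => b1 /andP[pq1 _] _.
  case/splitPl: v2 p2 l2 b2 => q2 r2 lq2; rewrite cat_path last_cat lq2 => /andP[_ pr2] l2 b2.
  have := separatesP _ _ _ _ sepS a (q1 ++ r2) aA.
  rewrite cat_path last_cat lq1 pq1 pr2 => /(_ isT l2) /hasP[u].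
  rewrite -cat_cons mem_cat lastI mem_rcons inE lq1 -orbA => /or3P[/eqP->|uq|ur].
  - by move=> /(negP vS).
  - by have := b1 u; rewrite mem_cat uq !inE negb_or => /(_ isT) /andP[_ /negP].
  - by have := b2 u; rewrite mem_cat ur orbT !inE negb_or => /(_ isT) /andP[_ /negP].
pose hd2 j := head x (P2 j); pose l1 i := last x (P1 i).
have P1E i : exists a s, [/\ P1 i = a :: s, path e' a s, a \in A & last a s = l1 i].
  by have [a [s [[E ? ? ?] _]]] := linkP (P1l i); exists a, s; split=> //; rewrite /l1 E.
have P2E j : exists s, [/\ P2 j = hd2 j :: s, path e' (hd2 j) s & last (hd2 j) s \in B].
  by have [a [s [[E ? ? ?] _]]] := linkP (P2l j); exists s; rewrite /hd2 E.
have l1P i : l1 i \in P1 i by have [a [s [E _ _ l]]] := P1E i; rewrite -l E mem_last.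
have h2P j : hd2 j \in P2 j by have [s [E _ _]] := P2E j; rewrite [in X in _ \in X]E mem_head.
have l1S i : l1 i \in x |: S.
  by have [a [s [[E ? ? ?] _]]] := linkP (P1l i); rewrite /l1 E.
have h2S j : hd2 j \in y |: S.
  by have [a [s [[E ? ? ?] _]]] := linkP (P2l j); rewrite /hd2 E.
have dinj (Q : 'I_k -> seq T) u i j : (forall i j, i != j -> [disjoint Q i & Q j]) ->
    u \in Q i -> u \in Q j -> i = j.
  move=> dQ ui uj; apply/eqP; apply: contraT => /dQ dij.
  by rewrite (disjointFr dij ui) in uj.
have h2inj : injective hd2.
  by move=> i j E; apply: (dinj _ (hd2 i) _ _ P2d); rewrite // E.
have l1inj : injective l1.
  by move=> i j E; apply: (dinj _ (l1 i) _ _ P1d); rewrite // E.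
(* A path of the first family ending at [x] continues through the deleted pair with the path
   starting at [y]; any other continues with the path starting at its own last vertex. *)
pose nx v := if v == x then y else v.
have sg i : {j | hd2 j == nx (l1 i)}.
  apply/sigW; have [|j <-] := surj_count h2inj h2S cy (y := nx (l1 i)); last by exists j.
  have := l1S i; rewrite /nx !inE.
  by case: (eqVneq (l1 i) x) => [_ _|_ /= ->]; rewrite ?eqxx ?orbT.
pose sgm i := sval (sg i).
have sgE i : hd2 (sgm i) = nx (l1 i) by rewrite /sgm; case: (sg i) => j /= /eqP.
have sginj : injective sgm.
  move=> i j /(congr1 hd2); rewrite !sgE /nx => E; apply: l1inj; move: E.
  have := l1S i; have := l1S j; rewrite !inE.
  have [->|_] := eqVneq (l1 i) x; have [->|_] := eqVneq (l1 j) x => //= jS iS E.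
    by rewrite E jS in yS.
  by rewrite -E iS in yS.
apply: weak.
exists (fun i => P1 i ++ (if l1 i == x then P2 (sgm i) else behead (P2 (sgm i)))); split.
  move=> i; have [a [s [E1 p1 aA ls]]] := P1E i; have [t [E2 p2 tB]] := P2E (sgm i).
  exists a; rewrite E1 E2 /=; eexists; split=> //.
    rewrite cat_path (sub_path e'e p1) ls; move: p2; rewrite sgE /nx.
    by case: (eqVneq (l1 i) x) => [->|_] /= /(sub_path e'e) ->; rewrite ?exy.
  rewrite last_cat ls; move: tB; rewrite sgE /nx.
  by case: (eqVneq (l1 i) x).
have sub i v : v \in P1 i ++ (if l1 i == x then P2 (sgm i) else behead (P2 (sgm i))) ->
    v \in P1 i \/ v \in P2 (sgm i).
  by rewrite mem_cat => /orP[->|]; [left | right; move: b; case: ifP => // _ /mem_behead].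
have cross2 i j v : i != j -> v \in P1 i -> v \in P2 (sgm j) -> False.
  move=> nij v1 v2; have [vS vl vh] := cross _ _ _ v1 v2; case/eqP: nij.
  have {}vh : v = hd2 (sgm j) by rewrite vh /hd2; have [s [-> _ _]] := P2E (sgm j).
  apply: (dinj _ v _ _ P1d) => //; move: vh vS; rewrite sgE /nx.
  by case: eqP => [_ -> yS'|_ -> _]; [rewrite yS' in yS | apply: l1P].
move=> i j nij; apply: disjointI => v /sub[v1|v2] /sub[w1|w2].
- by case/eqP: nij; apply: (dinj _ v _ _ P1d).
- exact: cross2 nij v1 w2.
- by apply: cross2 w1 v2; rewrite eq_sym.
- by case/eqP: nij; apply/sginj/(dinj _ v _ _ P2d).
Qed.
End Menger.

(** * Edge deletion, contraction and minors *)

Section PathLists.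
Variable V : finType.
Implicit Types (G : graph V) (A B : {set V}) (s : seq V).

Definition consecutive s (a b : V) : bool := infix [:: a; b] s || infix [:: b; a] s.

Lemma consecutive_sym s a b : consecutive s a b = consecutive s b a.
Proof. by rewrite /consecutive orbC. Qed.

Lemma consecutiveP s a b : consecutive s a b ->
  exists s1 s2, s = s1 ++ [:: a, b & s2] \/ s = s1 ++ [:: b, a & s2].
Proof.
by case/orP=> /infixP[s1 [s2 ->]]; exists s1, s2; [left | right].
Qed.

Lemma mem_consecutive s a b : consecutive s a b -> a \in s /\ b \in s.
Proof.
by case/consecutiveP => s1 [s2 [|]] ->; rewrite !mem_cat !inE !eqxx !orbT.
Qed.

Lemma path_betweenE x0 G A B s :
  path_between G A B s = [&& s != [::], head x0 s \in verts G, sorted (adj G) s,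
    uniq s, head x0 s \in A & last x0 s \in B].
Proof. by case: s. Qed.

Lemma sorted_split (e : rel V) s1 x s2 :
  sorted e (s1 ++ x :: s2) = sorted e (rcons s1 x) && path e x s2.
Proof.
case: s1 => [|y s1] //=.
by rewrite cat_path rcons_path /= andbA.
Qed.

Lemma uniq_notin s : uniq s -> forall s1 x s2, s = s1 ++ x :: s2 -> x \notin s1 ++ s2.
Proof.
move=> us s1 x s2 E; move: us; rewrite E cat_uniq /= negb_or mem_cat.
by case/and4P=> _ /andP[/negPf -> _] /negPf ->.
Qed.

Lemma rem_split s1 x s2 : x \notin s1 -> rem x (s1 ++ x :: s2) = s1 ++ s2.
Proof.
elim: s1 => [|y s1 IH] /=; first by rewrite eqxx.
by rewrite inE negb_or eq_sym => /andP[/negPf -> /IH ->].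
Qed.
End PathLists.

Section DeleteEdge.
Variables (V : finType) (G : graph V) (a b : V).

Definition del_adj : rel V :=
  [rel x y | adj G x y && ~~ (((x == a) && (y == b)) || ((x == b) && (y == a)))].

Fact del_sym : symmetric del_adj.
Proof.
move=> x y; rewrite /del_adj /= adj_sym orbC; congr (_ && ~~ _).
by congr (_ || _); apply: andbC.
Qed.

Fact del_irrefl : irreflexive del_adj.
Proof. by move=> x; rewrite /del_adj /= adj_irrefl. Qed.

Fact del_verts x y : del_adj x y -> x \in verts G.
Proof. by case/andP => /adj_verts. Qed.

Definition del_edge : graph V := Graph del_sym del_irrefl del_verts.

Lemma del_sorted s : ~~ consecutive s a b -> sorted (adj G) s -> sorted del_adj s.
Proof.
case: s => // x s; elim: s x => // y s IH x nab /andP[xy ys]; apply/andP; split.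
  apply/andP; split=> //; apply: contra nab; rewrite /consecutive !infix_consl !prefix_cons !prefix0s !andbT.
  by case/orP=> /andP[/eqP-> /eqP->]; rewrite !eqxx ?orbT.
apply: IH ys; apply: contra nab; rewrite /consecutive => /orP[] ab; apply/orP; [left|right].
  by rewrite infix_consl ab orbT.
by rewrite infix_consl ab orbT.
Qed.
End DeleteEdge.

Section Contraction.
Variables (V : finType) (G : graph V) (u v : V).

(** Contraction stays on the carrier [V]: [u] represents the merged vertex and [v] leaves the vertex
    set, so instances before and after a contraction have the same type. *)
Definition collapse (x : V) : V := if x == v then u else x.

Definition contract_adj : rel V := [rel x y | [&& x != y, x != v, y != v &
  [|| adj G x y, (x == u) && adj G v y | (y == u) && adj G x v]]].

Fact contract_sym : symmetric contract_adj.
Proof.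
move=> x y; rewrite /contract_adj /= eq_sym; congr (_ && _).
rewrite andbCA; do 2 congr (_ && _); rewrite adj_sym; congr (_ || _).
by rewrite orbC adj_sym [in X in _ || X]adj_sym.
Qed.

Fact contract_irrefl : irreflexive contract_adj.
Proof. by move=> x; rewrite /contract_adj /= eqxx. Qed.

Fact contract_verts x y : contract_adj x y -> x \in (u |: verts G) :\ v.
Proof.
case/and4P=> _ xv _; rewrite !inE xv /= => /or3P[/adj_verts->|/andP[-> _]|/andP[_ /adj_verts->]] //.
  by rewrite orbT.
by rewrite orbT.
Qed.

Definition contract : graph V := Graph contract_sym contract_irrefl contract_verts.

Hypothesis uv : adj G u v.

Let nuv : u != v.
Proof. by apply: contraTneq uv => ->; rewrite adj_irrefl. Qed.

Lemma contract_sub x y : x != v -> y != v -> adj G x y -> contract_adj x y.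
Proof.
move=> xv yv xy; rewrite /contract_adj /= xv yv xy /= andbT.
by apply: contraTneq xy => ->; rewrite adj_irrefl.
Qed.

Lemma contract_sorted s : v \notin s -> sorted (adj G) s -> sorted contract_adj s.
Proof.
move=> vs; apply: (@sub_in_sorted _ [pred x | x != v]).
  by move=> x y; rewrite !inE; apply: contract_sub.
by apply/allP => x xs /=; apply: contraNneq vs => <-.
Qed.

Lemma contract_rem_sorted s : uniq s -> consecutive s u v -> sorted (adj G) s ->
  sorted contract_adj (rem v s).
Proof.
move=> us /consecutiveP[s1 [s2 [] E]]; have := us; rewrite E.
  rewrite -cat_rcons => /uniq_notin /(_ _ _ _ erefl) nv.
  have nv1 : v \notin rcons s1 u by move: nv; rewrite mem_cat negb_or => /andP[].
  rewrite rem_split // cat_rcons cat_rcons !sorted_split => /and3P[so1 _ so2].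
  apply/andP; split; first exact: contract_sorted.
  case: s2 so2 nv E => //= y s2 /andP[vy so2] nv E.
  move: nv; rewrite mem_cat inE !negb_or => /and3P[_ vy' nv2].
  apply/andP; split; last by apply: (@contract_sorted (y :: s2)); rewrite // inE negb_or vy'.
  rewrite /contract_adj /= nuv [y == v]eq_sym vy' eqxx vy /= ?orbT ?andbT.
  by apply: contraTneq us => Euy; rewrite E Euy cat_uniq /= !inE eqxx orbT /= !andbF.
move=> /uniq_notin /(_ _ _ _ erefl) nv.
have /andP[nv1 nv2] : (v \notin s1) && (v \notin u :: s2) by move: nv; rewrite mem_cat negb_or.
rewrite rem_split // sorted_split => /andP[so1 /andP[_ so2]].
rewrite sorted_split; apply/andP; split; last first.
  by apply: (@contract_sorted (u :: s2)).
case/lastP: s1 so1 nv1 E {nv} => // s1 y.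
rewrite -[rcons (rcons s1 y) v]cats1 -[rcons (rcons s1 y) u]cats1 !cat_rcons.
rewrite !sorted_split => /andP[so1 /=]; rewrite !andbT => yv nv1 E.
apply/andP; split; first exact: contract_sorted.
rewrite /contract_adj /= nuv eqxx yv /= ?orbT ?andbT; apply/andP; split.
  by apply/eqP => Eyu; move: us; rewrite E Eyu cat_uniq /= !inE eqxx /= !orbT !andbF.
by apply: contraTneq yv => ->; rewrite adj_irrefl.
Qed.

(** In these two cases the image of the path is obtained by deleting [v] from the list. A list
    through [v] but not along the edge would need renaming, and could then collide with another list
    through [u]. *)
Lemma contract_path_between (A B : {set V}) s : v \notin s \/ consecutive s u v ->
  path_between G A B s -> path_between contract (collapse @: A) (collapse @: B) (rem v s).
Proof.
rewrite !(path_betweenE v) => H /and5P[sn hv so us /andP[hA lB]].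
have nuE : (u == v) = false by apply/negbTE.
have mh x : v != x -> collapse x = x by rewrite /collapse eq_sym => /negPf ->.
suff [t0 th tl ts] : [/\ rem v s != [::], head v (rem v s) = collapse (head v s),
    last v (rem v s) = collapse (last v s) & sorted contract_adj (rem v s)].
  rewrite rem_uniq // t0 th tl ts !imset_f //= !andbT !inE /collapse.
  by have [_|->] := eqVneq (head v s) v; rewrite ?eqxx ?nuE ?hv ?orbT.
case: H => [vs | cs].
  rewrite rem_id // contract_sorted //.
  have [/mh -> /mh -> //] : v != head v s /\ v != last v s.
  split; apply: contraNneq vs => E.
    by rewrite {1}E; case: (s) sn => //= *; rewrite mem_head.
  by rewrite {1}E; case: (s) sn => //= *; rewrite mem_last.
have sc := contract_rem_sorted us cs so.
have head_cat s1 x s2 : head v (s1 ++ x :: s2) = head x s1 by case: s1.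
have mhead s1 x : v \notin s1 -> (x == u) || (x == v) -> head u s1 = collapse (head x s1).
  case: s1 => [_|y s1] /=; last by rewrite inE negb_or => /andP[/mh].
  by rewrite /collapse => /orP[] /eqP ->; rewrite ?nuE ?eqxx.
have mlast s2 x : v \notin s2 -> (x == u) || (x == v) -> last u s2 = collapse (last x s2).
  elim/last_ind: s2 => [_|s2 y _] /=; last first.
    by rewrite mem_rcons inE negb_or !last_rcons => /andP[/mh].
  by rewrite /collapse => /orP[] /eqP ->; rewrite ?nuE ?eqxx.
have [s1 [s2 [] E]] := consecutiveP cs; have := us; rewrite E.
  rewrite -cat_rcons => /uniq_notin /(_ _ _ _ erefl).
  rewrite mem_cat mem_rcons inE !negb_or => /andP[/andP[vu v1] v2].
  move: sc; rewrite E -cat_rcons rem_split ?mem_rcons ?inE ?negb_or ?vu //.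
  rewrite !cat_rcons !head_cat !last_cat /= -mhead ?eqxx // -mlast ?eqxx ?orbT //.
  by split=> //; case: (s1).
move=> /uniq_notin /(_ _ _ _ erefl); rewrite mem_cat inE !negb_or => /and3P[v1 vu v2].
move: sc; rewrite E rem_split // !head_cat !last_cat /= -mhead ?eqxx ?orbT // -mlast ?eqxx //.
by split=> //; case: (s1).
Qed.

(** A walk of the contraction lifts to [G] with detours along the edge [u v]. The detours avoid [S],
    because [u \notin S'] excludes both [u] and [v] from [S]. *)
Lemma contract_separates (A B S S' : {set V}) : collapse @: S \subset S' ->
  separates (adj G) A B S -> separates contract_adj (collapse @: A) (collapse @: B) S'.
Proof.
move=> /subsetP SS' sep.
have SN x : collapse x \notin S' -> x \notin S by apply: contra => xS; apply/SS'/imset_f.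
have muE : collapse u = u by rewrite /collapse (negPf nuv).
have mvE : collapse v = u by rewrite /collapse eqxx.
have mE x : x != v -> collapse x = x by rewrite /collapse => /negPf ->.
have cuv : u \notin S' -> connect (avoid (adj G) S) u v /\ connect (avoid (adj G) S) v u.
  move=> uS; have uS1 : u \notin S by rewrite SN ?muE.
  have vS1 : v \notin S by rewrite SN ?mvE.
  by split; apply: connect1; rewrite /avoid /= uS1 vS1 // adj_sym.
have lift x y : connect (avoid contract_adj S') x y -> connect (avoid (adj G) S) x y.
  apply: connect_sub => {}x {}y /and3P[xS yS /and4P[_ xv yv xy]].
  have xS1 : x \notin S by rewrite SN ?mE.
  have yS1 : y \notin S by rewrite SN ?mE.
  case/or3P: xy => [xy | /andP[/eqP xu vy] | /andP[/eqP yu xv']].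
  - by apply: connect1; rewrite /avoid /= xS1 yS1.
  - rewrite xu in xS *; have [c _] := cuv xS; apply: connect_trans c _; apply: connect1.
    by rewrite /avoid /= yS1 vy (SN v) ?mvE.
  - rewrite yu in yS *; have [_ c] := cuv yS; apply: connect_trans _ c; apply: connect1.
    by rewrite /avoid /= xS1 xv' (SN v) ?mvE.
have cm x : collapse x \notin S' ->
    connect (avoid (adj G) S) x (collapse x) /\ connect (avoid (adj G) S) (collapse x) x.
  by have [-> | /mE ->] := eqVneq x v; [rewrite mvE => /cuv[] | split].
apply/forall_inP => a /setDP[/imsetP[a0 aA ->] aS].
apply/forall_inP => b /setDP[/imsetP[b0 bB ->] bS].
have := forall_inP (forall_inP sep a0 _) b0; rewrite !inE !SN // => /(_ aA bB).
apply: contra => /lift c; have [c1 _] := cm _ aS; have [_ c2] := cm _ bS.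
exact: connect_trans c1 (connect_trans c c2).
Qed.

Definition size_edges (V0 : finType) (G0 : graph V0) := #|[set e : V0 * V0 | adj G0 e.1 e.2]|.

(** [f] injects the edges of the contraction into those of [G] by choosing for each an edge that it
    comes from; the contracted edge [(u, v)] is never chosen. *)
Lemma contract_size : size_edges contract < size_edges G.
Proof.
pose f (e : V * V) := if adj G e.1 e.2 then e else
  if (e.1 == u) && adj G v e.2 then (v, e.2) else (e.1, v).
have fP x y : contract_adj x y -> [/\ x <> v, y <> v, x <> y & [\/ f (x, y) = (x, y) /\ adj G x y,
    [/\ f (x, y) = (v, y), x = u & adj G v y] | [/\ f (x, y) = (x, v), y = u & adj G x v]]].
  case/and4P => /eqP nxy /eqP xv /eqP yv H; split=> //; move: H; rewrite /f /=.
  case: (adj G x y) => /= [_|]; first by constructor 1.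
  by case: ifP => /= [/andP[/eqP h1 h2] _|_ /andP[/eqP h1 h2]]; [constructor 2 | constructor 3].
have finj : {in [set e : V * V | contract_adj e.1 e.2] &, injective f}.
  move=> [x y] [x' y']; rewrite !inE /= => /fP[xv yv nxy c] /fP[xv' yv' nxy' c'] E.
  by case: c => [[fE _]|[fE h _]|[fE h _]]; case: c' => [[fE' _]|[fE' h' _]|[fE' h' _]];
    move: E; rewrite fE fE' => -[]; congruence.
rewrite /size_edges -(card_in_imset finj); apply: proper_card; apply/properP; split.
  apply/subsetP => e0 /imsetP[[x y]]; rewrite inE => /fP[xv yv nxy c] ->; rewrite inE.
  by case: c => [[-> h]|[-> _ h]|[-> _ h]].
exists (u, v); rewrite ?inE //=; apply/imsetP => -[[x y]]; rewrite !inE => /fP[xv yv nxy c].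
have /eqP nuv' := nuv.
by case: c => [[-> _]|[-> _ _]|[-> h _]] E; have := congr1 fst E; have := congr1 snd E; move=> /=; congruence.
Qed.
End Contraction.

Lemma del_size (V : finType) (G : graph V) (a b : V) : adj G a b ->
  size_edges (del_edge G a b) < size_edges G.
Proof.
move=> ab; apply: proper_card; apply/properP; split.
  by apply/subsetP => -[x y]; rewrite !inE => /andP[].
by exists (a, b); rewrite inE //= /del_adj /= !eqxx andbF.
Qed.

Lemma connected_union (V : finType) (H : graph V) (S1 S2 : {set V}) x y :
  connected (induced H S1) -> connected (induced H S2) ->
  x \in S1 -> y \in S2 -> adj H x y -> connected (induced H (S1 :|: S2)).
Proof.
move=> [n1 c1] [n2 c2] xS yS xy; split.
  by apply: contra_neq n1 => /= E; apply/eqP; rewrite -subset0 -E setIS // subsetUl.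
have csym := sym_connect_sym (adj_sym (induced H (S1 :|: S2))).
have m1 : subrel (connect (adj (induced H S1))) (connect (adj (induced H (S1 :|: S2)))).
  apply: connect_sub => a b /and3P[aS bS ab]; apply: connect1.
  by rewrite /= /induced_adj /= !inE aS bS.
have m2 : subrel (connect (adj (induced H S2))) (connect (adj (induced H (S1 :|: S2)))).
  apply: connect_sub => a b /and3P[aS bS ab]; apply: connect1.
  by rewrite /= /induced_adj /= !inE aS bS !orbT.
have xH := adj_verts xy; have yH : y \in verts H by move: xy; rewrite adj_sym => /adj_verts.
have cx a : a \in verts (induced H (S1 :|: S2)) -> connect (adj (induced H (S1 :|: S2))) x a.
  rewrite /= !inE => /andP[aH /orP[a1|a2]].
    by apply: m1; apply: c1; rewrite /= inE ?xH ?aH.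
  apply: (@connect_trans _ _ y); last by apply: m2; apply: c2; rewrite /= inE ?yH ?aH.
  by apply: connect1; rewrite /= /induced_adj /= !inE xS yS xy !orbT.
by move=> a b aV bV; apply: connect_trans (cx b bV); rewrite csym; apply: cx.
Qed.

Lemma minor_refl (V : finType) (H : graph V) : minor H H.
Proof.
exists (fun x => [set x]); split.
- by move=> x xH; rewrite sub1set.
- move=> x xH; split; first by apply/set0Pn; exists x; rewrite /= !inE xH /=.
  by move=> a b; rewrite /= !inE => /andP[_ /eqP ->] /andP[_ /eqP ->]; apply: connect0.
- by move=> x y _ _ nxy; rewrite disjoints1 inE.
- by move=> x y xy; exists x, y; rewrite !inE.
Qed.

Lemma minor_del (V : finType) (G H : graph V) a b : minor G H -> minor (del_edge G a b) H.
Proof.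
case=> phi [s c d ad]; exists phi; split=> // x y /andP[xy _]; exact: ad.
Qed.

Lemma minor_contract (V : finType) (G H : graph V) u v : adj G u v -> minor G H ->
  minor (contract G u v) H.
Proof.
move=> uv [phi [s c d ad]].
have uG := adj_verts uv; have vG : v \in verts G by move: uv; rewrite adj_sym => /adj_verts.
have nuv : u != v by apply: contraTneq uv => ->; rewrite adj_irrefl.
have inG x : x \in verts (contract G u v) -> x \in verts G /\ x != v.
  by rewrite !inE => /andP[xv /predU1P[->|]].
exists (fun x => if x == u then phi u :|: phi v else phi x); split.
- by move=> x /inG[xG _]; case: ifP => _; rewrite ?subUset ?s.
- move=> x /inG[xG _]; case: ifP => _; last exact: c.
  by have [a [b [au bv ab]]] := ad _ _ uv; apply: connected_union (c _ uG) (c _ vG) au bv ab.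
- move=> x y /inG[xG xv] /inG[yG yv] nxy.
  have [xu|xu] := eqVneq x u; have [yu|yu] := eqVneq y u.
  + by rewrite xu yu eqxx in nxy.
  + by rewrite -setI_eq0 setIUl setU_eq0 !setI_eq0 !d // eq_sym.
  + by rewrite -setI_eq0 setIUr setU_eq0 !setI_eq0 !d // eq_sym.
  + exact: d.
- move=> x y /and4P[nxy xv yv /or3P[xy|/andP[/eqP xu vy]|/andP[/eqP yu xv']]].
  + have [a [b [aX bY ab]]] := ad _ _ xy; exists a, b; split=> //.
      by case: eqP aX => [->|//]; rewrite inE => ->.
    by case: eqP bY => [->|//]; rewrite inE => ->.
  + have [a [b [aX bY ab]]] := ad _ _ vy; exists a, b; split=> //.
      by rewrite xu eqxx inE aX orbT.
    by rewrite -xu eq_sym (negPf nxy).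
  + have [a [b [aX bY ab]]] := ad _ _ xv'; exists a, b; split=> //.
      by rewrite -yu (negPf nxy).
    by rewrite yu eqxx inE bY orbT.
Qed.

(** * Minimal instances *)

Lemma sorted_consecutive (V : finType) (G : graph V) s a b :
  sorted (adj G) s -> consecutive s a b -> adj G a b.
Proof.
move=> so /consecutiveP[s1 [s2 [] E]]; move: so; rewrite E sorted_split.
  by case/andP=> _ /= /andP[].
by case/andP=> _ /= /andP[]; rewrite adj_sym.
Qed.

Lemma contract_sorted_rem (V : finType) (G : graph V) (u v : V) s : adj G u v ->
  uniq s -> v \notin s \/ consecutive s u v -> sorted (adj G) s ->
  sorted (contract_adj G u v) (rem v s).
Proof.
move=> uv us [vs | cs] so; last exact: contract_rem_sorted.
by rewrite rem_id // contract_sorted.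
Qed.

Lemma rem_disjoint (V : eqType) (x : V) (s t : seq V) :
  (forall v, v \in s -> v \in t -> False) -> forall v, v \in rem x s -> v \in rem x t -> False.
Proof. by move=> d v /mem_rem vs /mem_rem vt; apply: d vt. Qed.

Lemma disjointE (T : finType) (s t : seq T) v : [disjoint s & t] -> v \in s -> v \in t -> False.
Proof. by move=> d vs vt; rewrite (disjointFr d vs) in vt. Qed.

Section Instances.
Variables (V : finType) (H : graph V) (m p K rho : nat) (Z : nat -> {set 'I_m}).
Implicit Types (G : graph V) (U W : {set V}) (P : 'I_m -> seq V) (Y : nat -> {set V}).

Definition layer (P : 'I_m -> seq V) (k : nat) : {set V} :=
  [set x | [exists j in Z k, x \in P j]].

(** What deletions and contractions must preserve. The [P j] are kept only as disjoint lists that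
    carry the layers, without their ends in [A] and [B]. The index sets [Z k] are fixed, since
    contraction changes the lists and not their indices, whereas [Y k] moves with the vertices. *)
Record instance G U W P Y : Prop := {
  inst_minor : minor G H;
  inst_link : disjoint_paths G U W p;
  inst_sorted : forall j, sorted (adj G) (P j);
  inst_uniq : forall j, uniq (P j);
  inst_disj : forall i j, i != j -> [disjoint P i & P j];
  inst_sep : forall k, k < K -> separates (adj G) U W (layer P k :|: Y k);
  inst_card : forall k, k < K -> #|Y k| <= rho
}.

Lemma inst_del G U W P Y a b : instance G U W P Y ->
  (forall j, ~~ consecutive (P j) a b) -> disjoint_paths (del_edge G a b) U W p ->
  instance (del_edge G a b) U W P Y.
Proof.
case=> mi li so un di se ca nP li'; split=> //.
- exact: minor_del.
- by move=> j; apply: del_sorted.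
- by move=> k kK; apply: separates_sub (se k kK) => x y /andP[].
Qed.

(** Taking the edge on some [P j] ensures that no other path contains [u] or [v], so every path is
    only shortened and the image of a layer is again covered by the same path indices. The last
    hypothesis does the same for the strands. *)
Lemma inst_contract G U W P Y u v (R : 'I_p -> seq V) : instance G U W P Y ->
  (forall i, path_between G U W (R i)) -> pairwise_disjoint R ->
  (exists j, consecutive (P j) u v) ->
  (forall i, v \notin R i \/ consecutive (R i) u v) ->
  instance (contract G u v) (collapse u v @: U) (collapse u v @: W)
    (fun j => rem v (P j)) (fun k => collapse u v @: Y k).
Proof.
case=> mi _ so un di se ca Rp Rd [j0 cj0] Rv.
have uv := sorted_consecutive (so j0) cj0.
have nuv : u != v by apply: contraTneq uv => ->; rewrite adj_irrefl.
have [uj0 vj0] := mem_consecutive cj0.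
have Pv j : v \notin P j \/ consecutive (P j) u v.
  have [->|/di nj] := eqVneq j j0; first by right.
  by left; apply/negP => vj; apply: disjointE nj vj vj0.
split=> //.
- exact: minor_contract.
- exists (fun i => rem v (R i)); split=> [i|i j nij]; first exact: contract_path_between.
  by apply: disjointI; apply: rem_disjoint => x; apply/disjointE/Rd.
- by move=> j; apply: contract_sorted_rem.
- by move=> j; apply: rem_uniq.
- by move=> i j nij; apply: disjointI; apply: rem_disjoint => x; apply/disjointE/di.
- move=> k kK; apply: contract_separates (se k kK) => //.
  apply/subsetP => _ /imsetP[x xS ->]; move: xS; rewrite !inE => /orP[|xY]; last first.
    by rewrite imset_f ?orbT.
  case/exists_inP => j jZ xj; apply/orP; left; apply/exists_inP; exists j => //.
  rewrite /collapse; case: eqVneq => [xv|nxv]; last by rewrite mem_rem_uniq // inE nxv.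
  have -> : j = j0.
    by apply/eqP; apply: contraT => /di d; case: (disjointE d xj); rewrite xv.
  by rewrite mem_rem_uniq // inE nuv.
- by move=> k kK; apply: leq_trans (ca k kK); apply: leq_imset_card.
Qed.

Lemma minimal_instance G U W P Y : instance G U W P Y ->
  exists G' U' W' P' Y', instance G' U' W' P' Y' /\
    (forall G2 U2 W2 P2 Y2, instance G2 U2 W2 P2 Y2 -> size_edges G' <= size_edges G2).
Proof.
have [n] := ubnP (size_edges G); elim: n => // n IH in G U W P Y * => /ltnSE len inst.
case: (classic (exists G2 U2 W2 P2 Y2, instance G2 U2 W2 P2 Y2 /\ size_edges G2 < size_edges G)).
  by case=> [G2 [U2 [W2 [P2 [Y2 [i2 lt2]]]]]]; apply: IH i2; apply: leq_trans lt2 len.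
move=> none; exists G, U, W, P, Y; split=> // G2 U2 W2 P2 Y2 i2; rewrite leqNgt.
by apply/negP => lt2; apply: none; exists G2, U2, W2, P2, Y2.
Qed.

Section Minimal.
Variables (G : graph V) (U W : {set V}) (P : 'I_m -> seq V) (Y : nat -> {set V}).
Variable R : 'I_p -> seq V.
Hypothesis inst : instance G U W P Y.
Hypothesis min_inst : forall G2 U2 W2 P2 Y2, instance G2 U2 W2 P2 Y2 ->
  size_edges G <= size_edges G2.
Hypothesis Rp : forall i, path_between G U W (R i).
Hypothesis Rd : pairwise_disjoint R.

(** Such an edge could be contracted: its ends lie on no other strand and on no other path. *)
Lemma min_no_shared r j a b : consecutive (R r) a b -> consecutive (P j) a b -> False.
Proof.
move=> cR cP; have ab := sorted_consecutive (inst_sorted inst j) cP.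
suff /min_inst : instance (contract G a b) (collapse a b @: U) (collapse a b @: W)
    (fun j => rem b (P j)) (fun k => collapse a b @: Y k) by rewrite leqNgt contract_size.
apply: inst_contract Rp Rd _ _ => //; first by exists j.
move=> i; have [->|nir] := eqVneq i r; first by right.
left; apply/negP => bi; have [_ br] := mem_consecutive cR.
exact: disjointE (Rd nir) bi br.
Qed.

(** If [a] were on no strand, contracting it into [b] would leave the strands unchanged as lists and
    shorten [P j] only. *)
Lemma min_on_link j a b : consecutive (P j) a b -> exists r, a \in R r.
Proof.
move=> cP; apply: NNPP => aR; rewrite consecutive_sym in cP.
have ba := sorted_consecutive (inst_sorted inst j) cP.
suff /min_inst : instance (contract G b a) (collapse b a @: U) (collapse b a @: W)
    (fun j => rem a (P j)) (fun k => collapse b a @: Y k) by rewrite leqNgt contract_size.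
apply: inst_contract Rp Rd _ _ => //; first by exists j.
by move=> i; left; apply/negP => ai; apply: aR; exists i.
Qed.

(** The edge lies on no path by [min_no_shared], and deleting edges preserves separation, so a
    linkage without it would give a smaller instance. *)
Lemma min_link_edge r a b : consecutive (R r) a b ->
  ~ disjoint_paths (del_edge G a b) U W p.
Proof.
move=> cR li; have ab : adj G a b.
  by apply: sorted_consecutive cR; have := Rp r; rewrite (path_betweenE a) => /and5P[].
suff /min_inst : instance (del_edge G a b) U W P Y by rewrite leqNgt del_size.
by apply: inst_del => // j; apply/negP; apply: min_no_shared cR.
Qed.
End Minimal.
End Instances.

Lemma mem_take_index (T : eqType) (s : seq T) n v :
  (v \in take n s) = (v \in s) && (index v s < n).
Proof.
case: (boolP (v \in s)) => vs; first exact: in_take.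
by apply/negP => /mem_take; apply/negP.
Qed.

Lemma mem_drop_index (T : eqType) (s : seq T) n v : uniq s ->
  v \in drop n s -> v \in s /\ n <= index v s.
Proof.
move=> us vd; have vs := mem_drop vd; split=> //; rewrite leqNgt; apply/negP => lt.
have vt : v \in take n s by rewrite mem_take_index vs.
move: us; rewrite -{1}(cat_take_drop n s) cat_uniq => /and3P[_ /hasP[]].
by exists v.
Qed.

(** * Sweeping the strands by frontiers *)

Section Sweep.
Variables (V : finType) (G : graph V) (U W : {set V}) (p : nat) (R : 'I_p -> seq V).
Hypothesis Rp : forall i, path_between G U W (R i).
Hypothesis Rd : pairwise_disjoint R.
Hypothesis Redge : forall r a b, consecutive (R r) a b ->
  ~ disjoint_paths (del_edge G a b) U W p.

Lemma linkage_inj i j v : v \in R i -> v \in R j -> i = j.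
Proof. by move=> vi vj; apply/eqP; apply: contraT => /Rd d; case: (disjointE d vi vj). Qed.

Lemma linkage_uniq i : uniq (R i).
Proof. by have := Rp i; case: (R i) => // x s /and5P[]. Qed.

Lemma linkage_sorted i : sorted (adj G) (R i).
Proof. by have := Rp i; case: (R i) => // x s /and5P[]. Qed.

Definition valid (f : 'I_p -> nat) := forall r, f r < size (R r).

(* The frontier vertex of [R r] is the one of index [f r]; no edge joins a vertex
   strictly before the frontier to one strictly after it. *)
Definition safe (f : 'I_p -> nat) := forall r r' x y, x \in R r -> y \in R r' ->
  adj G x y -> index x (R r) < f r -> index y (R r') <= f r'.

Definition bump (f : 'I_p -> nat) r i := f i + (i == r).

Lemma valid_bump f r : valid f -> (f r).+1 < size (R r) -> valid (bump f r).
Proof.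
by move=> vf fr i; rewrite /bump; case: eqP => [->|_]; rewrite ?addn1 ?addn0.
Qed.

(* If every strand were blocked, following the blocking edges would produce a
   cycle of strands along which prefixes and suffixes can be exchanged; the
   resulting linkage skips an edge of [R]. *)
Lemma advance f : valid f -> safe f -> (exists r, (f r).+1 < size (R r)) ->
  exists2 r, (f r).+1 < size (R r) & safe (bump f r).
Proof.
move=> vf sf [q0 hq0]; apply: NNPP => none.
have [x0 _] : exists x0, x0 \in R q0.
  by case: (R q0) hq0 => // x s _; exists x; rewrite mem_head.
pose cur r := nth x0 (R r) (f r).
pose bad r r2 y := [&& y \in R r2, adj G (cur r) y & bump f r r2 < index y (R r2)].
pose NE := [set r | (f r).+1 < size (R r)].
have curR r : cur r \in R r by rewrite mem_nth.
have icur r : index (cur r) (R r) = f r by rewrite index_uniq // linkage_uniq.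
(* Edges from vertices before the old frontier obey [safe f]. An edge that makes [bump f r] unsafe
   therefore starts at the frontier vertex [cur r] itself. *)
have badP r : exists r2y : 'I_p * V, r \in NE -> bad r r2y.1 r2y.2.
  case: (pickP [pred r2y : 'I_p * V | bad r r2y.1 r2y.2]) => [a ba | nb].
    by exists a.
  exists (r, x0); rewrite inE => hr; case: none; exists r => //.
  move=> a b x y xa yb xy; rewrite {1}/bump => ix.
  have [lt|ge] := ltnP (index x (R a)) (f a).
    by apply: leq_trans (sf _ _ _ _ xa yb xy lt) _; rewrite leq_addr.
  have ar : a = r by apply/eqP; apply: contraT => /negPf nar; move: ix; rewrite nar addn0 ltnNge ge.
  rewrite {a}ar eqxx in xa ix ge; have xc : x = cur r.
    rewrite /cur.
    have -> : f r = index x (R r); last by rewrite nth_index.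
    move: ix; rewrite -[nat_of_bool true]/1 addn1 ltnS => ix.
    by apply/eqP; rewrite eqn_leq ge ix.
  by have /negbT := nb (b, y); rewrite /= /bad yb -xc xy /= -leqNgt.
have [nt ntP] := fin_all_exists badP.
pose nx r := (nt r).1; pose tg r := (nt r).2; pose g r := index (tg r) (R (nx r)).
have ntB r : r \in NE -> [/\ tg r \in R (nx r), adj G (cur r) (tg r) & bump f r (nx r) < g r].
  by move=> /ntP /and3P[].
have gf r : r \in NE -> f (nx r) < g r.
  by case/ntB => _ _; apply: leq_ltn_trans; rewrite leq_addr.
have gsz r : r \in NE -> g r < size (R (nx r)) by case/ntB => h _ _; rewrite index_mem.
have nxNE r : r \in NE -> nx r \in NE.
  by move=> hr; rewrite inE; have := gf _ hr; have := gsz _ hr; lia.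
(* On a minimal nonempty set closed under [nx], the map [nx] is a permutation, so no suffix is
   assigned to two strands. *)
pose Q (C : {set 'I_p}) := [&& C != set0, C \subset NE & nx @: C \subset C].
have [|C /minsetP[/and3P[C0 CNE nxC] Cmin] _] := @minset_exists _ Q NE.
  apply/and3P; split=> //; first by apply/set0Pn; exists q0; rewrite inE.
  by apply/subsetP => _ /imsetP[r hr ->]; apply: nxNE.
have nxinj : {in C &, injective nx}.
  apply/imset_injP; rewrite (Cmin (nx @: C)) //; apply/and3P; split.
  - by have /set0Pn[r rC] := C0; apply/set0Pn; exists (nx r); rewrite imset_f.
  - exact: subset_trans nxC CNE.
  - exact: imsetS.
have NEC r : r \in C -> r \in NE by apply/subsetP.
have nxCC r : r \in C -> nx r \in C by move=> rC; apply/(subsetP nxC)/imset_f.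
(* The prefixes end at the frontier and the suffixes begin strictly beyond it, so the exchanged
   strands remain disjoint. *)
pose R' r := if r \in C then take (f r).+1 (R r) ++ drop (g r) (R (nx r)) else R r.
have R'P i v : v \in R' i -> (v \in R i /\ (i \in C -> index v (R i) <= f i)) \/
    [/\ i \in C, v \in R (nx i) & g i <= index v (R (nx i))].
  rewrite /R'; case: ifP => [iC|_]; last by left.
  rewrite mem_cat mem_take_index => /orP[/andP[vi ?]|/mem_drop_index]; first by left.
  by case; [exact: linkage_uniq | right].
have R'd : pairwise_disjoint R'.
  move=> i j nij; apply: disjointI => v /R'P[[vi hi]|[iC vi hi]] /R'P[[vj hj]|[jC vj hj]].
  - by case/eqP: nij; apply: linkage_inj vi vj.
  - have ij := linkage_inj vi vj; have iC : i \in C by rewrite ij nxCC.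
    by have := hi iC; have := gf _ (NEC _ jC); move: hj; rewrite ij; lia.
  - have ij := linkage_inj vi vj; have jC : j \in C by rewrite -ij nxCC.
    by have := hj jC; have := gf _ (NEC _ iC); move: hi; rewrite ij; lia.
  - by case/eqP: nij; apply: nxinj => //; apply: linkage_inj vi vj.
have [r0 r0C] := set0Pn _ C0.
have f0 : (f r0).+1 < size (R r0) by have := NEC _ r0C; rewrite inE.
pose a := cur r0; pose b := nth x0 (R r0) (f r0).+1.
have bR : b \in R r0 by rewrite mem_nth.
have ib : index b (R r0) = (f r0).+1 by rewrite index_uniq // linkage_uniq.
have cab : consecutive (R r0) a b.
  apply/orP; left; apply/infixP; exists (take (f r0) (R r0)), (drop (f r0).+2 (R r0)).
  rewrite -{1}(cat_take_drop (f r0) (R r0)); congr (_ ++ _).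
  by rewrite (drop_nth x0) ?(ltnW f0) // (drop_nth x0).
apply: (Redge cab); exists R'; split=> // i.
(* Only [R' r0] contains [a]. It contains [b] only if [nx r0 = r0], and then its suffix starts
   beyond [b]: this is why [bad] compares with the bumped frontier. *)
have nab : ~~ consecutive (R' i) a b.
  apply/negP => /mem_consecutive[/R'P ha /R'P hb].
  case: ha => [[ai _]|[iC ai hai]]; last first.
    have E := linkage_inj (curR r0) ai; have := gf _ (NEC _ iC).
    by move: hai; rewrite -E icur; lia.
  have E := linkage_inj (curR r0) ai; rewrite -{i ai}E in hb *.
  case: hb => [[_ /(_ r0C)]|[_ bn hb]]; first by rewrite ib ltnn.
  have E := linkage_inj bR bn; have [_ _] := ntB _ (NEC _ r0C).
  by move: hb; rewrite /bump -E ib eqxx; lia.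
have hd := Rp i; rewrite (path_betweenE x0) in hd; have /and5P[s0 hv so us /andP[hU lW]] := hd.
suff : path_between G U W (R' i).
  rewrite !(path_betweenE x0) => /and5P[-> -> so' -> /andP[-> ->]].
  by rewrite /= del_sorted.
rewrite /R'; case: ifP => [iC|_] //; have [tR cadj bg] := ntB _ (NEC _ iC).
have hd2 := Rp (nx i); rewrite (path_betweenE x0) in hd2.
have /and5P[_ _ so2 us2 /andP[_ lW2]] := hd2.
have dE : drop (g i) (R (nx i)) = tg i :: drop (g i).+1 (R (nx i)).
  by rewrite (drop_nth x0) ?gsz ?NEC // /g nth_index.
have tE : take (f i).+1 (R i) = rcons (take (f i) (R i)) (cur i) by rewrite (take_nth x0).
have t0 : take (f i).+1 (R i) != [::] by rewrite tE; case: take.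
have hE : head x0 (take (f i).+1 (R i)) = head x0 (R i) by case: (R i) s0.
have lE : last (tg i) (drop (g i).+1 (R (nx i))) = last x0 (R (nx i)).
  by rewrite -[in RHS](cat_take_drop (g i) (R (nx i))) dE last_cat.
have hc : head x0 (take (f i).+1 (R i) ++ drop (g i) (R (nx i))) = head x0 (R i).
  by rewrite -hE; case: take t0.
have hs : sorted (adj G) (take (f i).+1 (R i) ++ drop (g i) (R (nx i))).
  rewrite tE cat_rcons dE sorted_split -tE take_sorted //= cadj.
  by have := drop_sorted (g i) so2; rewrite dE.
have hu : uniq (take (f i).+1 (R i) ++ drop (g i) (R (nx i))).
  rewrite cat_uniq take_uniq // drop_uniq // andbT; apply/hasPn => v vd.
  apply/negP; rewrite /= mem_take_index => /andP[vi hi].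
  have [vn hn] := mem_drop_index us2 vd; have E := linkage_inj vi vn.
  have := leq_trans (gf _ (NEC _ iC)) hn; rewrite -E => lt.
  by rewrite ltnS leqNgt lt in hi.
rewrite (path_betweenE x0) hc hv hU hs hu last_cat dE /= lE lW2.
by case: take t0.
Qed.

Variables (m : nat) (P : 'I_m -> seq V) (J : {set 'I_m}).
Hypothesis Pd : forall i j, i != j -> [disjoint P i & P j].

Lemma family_inj i j v : v \in P i -> v \in P j -> i = j.
Proof. by move=> vi vj; apply/eqP; apply: contraT => /Pd d; case: (disjointE d vi vj). Qed.

Definition hits (r : 'I_p) (j : 'I_m) := has [in P j] (R r).
(** A pair is counted once, at the first vertex of the strand on the path, so moving one frontier
    vertex forward by one step gains at most one pair. *)
Definition hit_index (r : 'I_p) (j : 'I_m) := find [in P j] (R r).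

Definition hits_before (f : 'I_p -> nat) :=
  [set a : 'I_p * 'I_m | [&& a.2 \in J, hits a.1 a.2 & hit_index a.1 a.2 < f a.1]].

Definition hits_total := [set a : 'I_p * 'I_m | (a.2 \in J) && hits a.1 a.2].

Lemma hit_index_inj r j j' : hits r j -> hits r j' ->
  hit_index r j = hit_index r j' -> j = j'.
Proof.
move=> hj hj' E; have [x0 _] : exists x0, x0 \in R r by case/hasP: hj => x xR _; exists x.
apply: (@family_inj _ _ (nth x0 (R r) (hit_index r j))); first exact: nth_find.
by rewrite E; apply: nth_find.
Qed.

Lemma hits_at_le1 r c :
  #|[set a : 'I_p * 'I_m | [&& a.1 == r, hits a.1 a.2 & hit_index a.1 a.2 == c]]| <= 1.
Proof.
apply/card_le1_eqP => -[r1 j1] [r2 j2]; rewrite !inE /=.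
move=> /and3P[/eqP -> h1 /eqP c1] /and3P[/eqP -> h2 /eqP c2].
by congr (_, _); apply: (hit_index_inj h2 h1); rewrite c1 c2.
Qed.

Lemma hits_before_bump f r : #|hits_before (bump f r)| <= #|hits_before f|.+1.
Proof.
rewrite -addn1; apply: leq_trans (leq_add (leqnn _) (hits_at_le1 r (f r))).
apply: leq_trans (leq_card_setU _ _); apply/subset_leq_card/subsetP => -[i j].
rewrite !inE /= /bump => /and3P[-> -> /=].
by case: (eqVneq i r) => [->|_] /=; rewrite ?addn1 ?addn0 ?ltnS ?orbF // leq_eqVlt orbC.
Qed.

Definition last_frontier (r : 'I_p) := (size (R r)).-1.

(** Valid frontiers never pass the last vertex of a strand; at most one pair per strand has its
    first meeting there. *)
Lemma hits_before_last : #|hits_total| <= #|hits_before last_frontier| + p.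
Proof.
pose L := [set a : 'I_p * 'I_m | hits a.1 a.2 && (hit_index a.1 a.2 == last_frontier a.1)].
have cL : #|L| <= p.
  rewrite -[leqRHS]card_ord -(@card_in_imset _ _ fst L); first exact: max_card.
  move=> [r1 j1] [r2 j2]; rewrite !inE /= => /andP[h1 /eqP c1] /andP[h2 /eqP c2] E.
  rewrite -E in h2 c2 *; congr (_, _).
  by apply: (hit_index_inj h1 h2); rewrite c1 c2.
apply: leq_trans (leq_add (leqnn _) cL); apply: leq_trans (leq_card_setU _ _).
apply/subset_leq_card/subsetP => -[r j]; rewrite !inE /= => /andP[-> h]; rewrite h /=.
have := h; rewrite /hits has_find -/(hit_index r j) => lt.
by rewrite orbC -leq_eqVlt -ltnS prednK //; apply: leq_ltn_trans lt.
Qed.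

Lemma hits_before0 : hits_before (fun _ => 0) = set0.
Proof. by apply/setP => a; rewrite !inE ltn0 !andbF. Qed.

Lemma valid0 : valid (fun _ => 0).
Proof. by move=> r; have := Rp r; case: (R r). Qed.

(** The count grows by at most one per step, so it cannot skip the value [c]; as long as it is below
    [c], some strand is not at its end and [advance] applies. *)
Lemma advance_to f c : valid f -> safe f -> #|hits_before f| <= c ->
  c <= #|hits_before last_frontier| ->
  exists f', [/\ valid f', safe f', forall r, f r <= f' r & #|hits_before f'| = c].
Proof.
have [n] := ubnP (\sum_r (size (R r) - f r)); elim: n => // n IH in f * => /ltnSE len vf sf lo hi.
have [E|ne] := eqVneq #|hits_before f| c; first by exists f.
have [|r hr sb] := advance vf sf.
  apply: NNPP => none; case/eqP: ne; apply/eqP; rewrite eqn_leq lo; apply: leq_trans hi _.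
  apply/subset_leq_card/subsetP => -[r j]; rewrite !inE /= => /and3P[-> -> /=].
  move=> h; apply: leq_trans h _; rewrite /last_frontier.
  rewrite leqNgt; apply/negP => lt; apply: none; exists r.
  by have := vf r; lia.
have vb := valid_bump vf hr.
have [||f' [vf' sf' ff' cf']] := IH _ _ vb sb _ hi.
- apply: leq_trans len; rewrite [ltnRHS](bigD1 r) //= [ltnLHS](bigD1 r) //=.
  rewrite {1}/bump eqxx -addSn; apply: leq_add; first by rewrite addn1; lia.
  by apply: leq_sum => i ni; rewrite /bump (negPf ni) addn0.
- by apply: leq_trans (hits_before_bump f r) _; rewrite ltn_neqAle ne lo.
- by exists f'; split=> // i; apply: leq_trans (ff' i); rewrite leq_addr.
Qed.

Lemma frontier_sequence M E : M * E <= #|hits_before last_frontier| ->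
  exists F : nat -> 'I_p -> nat, forall i, i <= M ->
    [/\ valid (F i), safe (F i), #|hits_before (F i)| = i * E &
        forall i', i <= i' <= M -> forall r, F i r <= F i' r].
Proof.
move=> hM; suff : exists F : nat -> 'I_p -> nat, forall i, i <= M ->
    [/\ valid (F i), safe (F i), #|hits_before (F i)| = i * E &
        i < M -> forall r, F i r <= F i.+1 r].
  case=> F HF; exists F => i iM; have [vF sF cF _] := HF i iM; split=> //.
  elim=> [|i' IH] /andP[ii' i'M] r; first by move: ii'; rewrite leqn0 => /eqP ->.
  move: ii'; rewrite leq_eqVlt => /predU1P[-> //|ii'].
  apply: leq_trans (IH _ r) _; first by rewrite -ltnS ii' ltnW.
  by have [_ _ _ ->] := HF i' (ltnW i'M).
elim: M hM => [|M IH] hM.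
  exists (fun _ _ => 0) => i; rewrite leqn0 => /eqP ->; split=> //.
  - exact: valid0.
  - by rewrite hits_before0 cards0.
have [|F HF] := IH; first by apply: leq_trans hM; rewrite leq_mul2r leqnSn orbT.
have [vF sF cF _] := HF M (leqnn M).
have [|f' [vf' sf' Ff' cf']] := @advance_to (F M) (M.+1 * E) vF sF _ hM.
  by rewrite cF leq_mul2r leqnSn orbT.
exists (fun i => if i <= M then F i else f') => i; rewrite leq_eqVlt => /predU1P[->|iM].
  by rewrite ltnn; split=> //; rewrite ltnn.
rewrite -ltnS iM; have [vFi sFi cFi Fi] := HF i iM; split=> // _ r.
have [iM'|iM'] := leqP i.+1 M; first exact: Fi.
by have -> : i = M by lia.
Qed.
End Sweep.

(** The strands that meet layer [k] in no path of [Z k] have distinct vertices in [Y k], so there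
    are at most [rho] of them. The index sets are disjoint, hence the pairs found in different
    layers are different. *)
Lemma hits_total_layers (V : finType) (G : graph V) (U W : {set V}) (p m K rho : nat)
    (R : 'I_p -> seq V) (P : 'I_m -> seq V) (J : {set 'I_m}) (Z : nat -> {set 'I_m})
    (Y : nat -> {set V}) :
  (forall i, path_between G U W (R i)) -> pairwise_disjoint R ->
  (forall k, k < K -> separates (adj G) U W (layer Z P k :|: Y k)) ->
  (forall k, k < K -> #|Y k| <= rho) ->
  (forall k, k < K -> Z k \subset J) ->
  (forall k k', k < k' < K -> [disjoint Z k & Z k']) ->
  K * (p - rho) <= #|hits_total R P J|.
Proof.
move=> Rp Rd sep cY ZJ Zd.
pose Hk k := [set a : 'I_p * 'I_m | (a.2 \in Z k) && hits R P a.1 a.2].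
have cH k : k < K -> p - rho <= #|Hk k|.
  move=> kK; pose Rk := [set r | [exists j in Z k, hits R P r j]].
  have : #|~: Rk| <= rho.
    have ex r : exists v, r \notin Rk -> (v \in R r) && (v \in Y k).
      have := Rp r; case ER: (R r) => [//|x s] /and5P[_ ps _ xU lW].
      have := separatesP _ _ _ _ (sep k kK) x s xU ps lW.
      case/hasP => v vs; rewrite !inE => /orP[/exists_inP[j jZ vj]|vY]; last first.
        by exists v => _; rewrite -ER vY ER vs.
      exists v; rewrite inE => /exists_inP[]; exists j => //; apply/hasP; exists v => //.
      by rewrite ER.
    have [h hP] := fin_all_exists ex; apply: leq_trans (cY k kK).
    rewrite -(@card_in_imset _ _ h (~: Rk)).
      apply/subset_leq_card/subsetP => _ /imsetP[r rR ->].
      by rewrite inE in rR; have /andP[] := hP _ rR.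
    move=> r r' /setCP /negP rR /setCP /negP rR' E.
    have /andP[h1 _] := hP _ rR; have /andP[h2 _] := hP _ rR'.
    by apply: (linkage_inj Rd h1); rewrite E.
  have := cardsC Rk; rewrite card_ord => cR cN.
  have : #|Rk| <= #|Hk k|; last by lia.
  apply: leq_trans (leq_imset_card fst (Hk k)); apply/subset_leq_card/subsetP => r.
  by rewrite inE => /exists_inP[j jZ h]; apply/imsetP; exists (r, j); rewrite ?inE ?jZ.
suff H n : n <= K -> n * (p - rho) <=
    #|[set a : 'I_p * 'I_m | [exists k : 'I_n, a \in Hk k]]|.
  apply: leq_trans (H K (leqnn K)) _; apply/subset_leq_card/subsetP => -[r j].
  rewrite !inE /= => /existsP[k]; rewrite inE /= => /andP[jZ ->].
  by rewrite (subsetP (ZJ k (ltn_ord k))).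
elim: n => // n IH nK; rewrite mulSn addnC.
apply: leq_trans (leq_add (IH (ltnW nK)) (cH n nK)) _.
rewrite -cardsUI (_ : _ :&: _ = set0) ?cards0 ?addn0.
  apply/subset_leq_card/subsetP => a; rewrite !inE => /orP[/existsP[k ak]|an].
    by apply/existsP; exists (widen_ord (leqnSn n) k).
  by apply/existsP; exists ord_max; rewrite inE.
apply/setP => -[r j]; rewrite !inE /=; apply/negP => /andP[/existsP[k]].
rewrite !inE /= => /andP[jk _] /andP[jn _].
have /Zd d : k < n < K by rewrite ltn_ord.
by rewrite (disjointFr d jk) in jn.
Qed.

Fact drop_one (u v q e e' nb : nat) :
  u + v < e + q -> e <= e' + nb -> nb <= u -> e' + q <= v -> False.
Proof. lia. Qed.

(** Adding the inequalities of both sides gains an extra [4 * w * s]. The elements counted twice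
    cost at most [2 * s * (x + y)], as [4 * w <= 2 * s], and this is less than [4 * w * s]. *)
Fact split_count (e e1 e2 s w a a1 a2 b b1 b2 x y : nat) : 0 < w -> 2 * w <= s ->
  e <= e1 + e2 -> a1 + a2 = a + x -> b1 + b2 = b + y -> x + y < 2 * w ->
  e1 + 4 * w * s <= 2 * s * b1 + 4 * w * a1 ->
  e2 + 4 * w * s <= 2 * s * b2 + 4 * w * a2 ->
  2 * s * b + 4 * w * a < e + 4 * w * s -> False.
Proof.
move=> w0 ws he ha hb hxy h1 h2 h.
have : 2 * s * b1 + 2 * s * b2 = 2 * s * b + 2 * s * y by rewrite -!mulnDr hb.
have : 4 * w * a1 + 4 * w * a2 = 4 * w * a + 4 * w * x by rewrite -!mulnDr ha.
have : 4 * w * x <= 2 * s * x by rewrite leq_mul2r; apply/orP; right; lia.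
have : 2 * s * x + 2 * s * y < 2 * s * (2 * w) by rewrite -mulnDr ltn_mul2l hxy; lia.
have : 2 * s * (2 * w) = 4 * w * s by lia.
lia.
Qed.

(** * Clusters inside slots *)

Section Bipartite.
Variables (T1 T2 : finType) (I : T1 -> T2 -> bool).
Implicit Types (A X : {set T1}) (B Y : {set T2}).

Definition incidences A B : {set T1 * T2} :=
  [set a | [&& a.1 \in A, a.2 \in B & I a.1 a.2]].

Definition share A B : rel T1 :=
  [rel r r' | [&& r \in A, r' \in A & [exists z in B, I r z && I r' z]]].

Lemma share_sym A B : symmetric (share A B).
Proof.
move=> r r'; rewrite /share /= andbCA; do 2 congr (_ && _).
by apply: eq_existsb => z; congr (_ && _); apply: andbC.
Qed.

(* A pair minimizing [|A| + |B|] among those with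
   [2 s |B| + 4 w |A| < e(A, B) + 4 w s] and [|A| >= s] cannot be split along
   fewer than [2 w] elements: otherwise one of the two sides would be smaller and
   still satisfy these conditions. *)
Lemma robust_subpair A B s w : 0 < w -> 2 * w <= s -> s <= #|A| ->
  2 * s * #|B| + 4 * w * #|A| <= #|incidences A B| ->
  exists A' B', [/\ A' \subset A /\ B' \subset B, 2 * s <= #|A'|,
    {in A', forall r, exists2 z, z \in B' & I r z},
    {in B', forall z, exists2 r, r \in A' & I r z} &
    forall X Y, #|X| + #|Y| < 2 * w ->
      {in A' :\: X &, forall r r', connect (share (A' :\: X) (B' :\: Y)) r r'}].
Proof.
move=> w0 ws sA hA.
pose good (S : {set T1} * {set T2}) := [&& S.1 \subset A, S.2 \subset B, s <= #|S.1| &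
  2 * s * #|S.2| + 4 * w * #|S.1| < #|incidences S.1 S.2| + 4 * w * s].
have gAB : good (A, B).
  have : 0 < 4 * w * s by rewrite !muln_gt0 w0 (leq_trans _ ws) // muln_gt0.
  by rewrite /good /= !subxx sA => h; apply: leq_ltn_trans hA _; rewrite -[ltnLHS]addn0 ltn_add2l.
have [[A' B'] gS min] := @arg_minnP _ (A, B) good (fun S => #|S.1| + #|S.2|) gAB.
have /and4P[/= AA BB sA' pot] := gS.
have minS A1 B1 : A1 \subset A' -> B1 \subset B' -> s <= #|A1| ->
    #|A1| + #|B1| < #|A'| + #|B'| ->
    #|incidences A1 B1| + 4 * w * s <= 2 * s * #|B1| + 4 * w * #|A1|.
  move=> sub1 sub2 s1 lt; rewrite leqNgt; apply/negP => pot1.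
  have := min (A1, B1); rewrite /good /= (subset_trans sub1) // (subset_trans sub2) // s1 pot1.
  by move=> /(_ isT); rewrite leqNgt lt.
pose nb1 z := [set r in A' | I r z]; pose nb2 r := [set z in B' | I r z].
have incB z : z \in B' -> #|incidences A' B'| <= #|incidences A' (B' :\ z)| + #|nb1 z|.
  move=> zB; rewrite -(card_imset (mem (nb1 z)) (f := fun r => (r, z))); last by move=> ? ? [].
  apply: leq_trans (leq_card_setU _ _); apply/subset_leq_card/subsetP => -[r z'].
  rewrite !inE /= => /and3P[rA zB' i]; rewrite rA zB' i /=.
  case: eqVneq => [E|//] /=; apply/imsetP; exists r; rewrite ?E //.
  by rewrite inE rA -E.
have incA r : r \in A' -> #|incidences A' B'| <= #|incidences (A' :\ r) B'| + #|nb2 r|.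
  move=> rA; rewrite -(card_imset (mem (nb2 r)) (f := fun z => (r, z))); last by move=> ? ? [].
  apply: leq_trans (leq_card_setU _ _); apply/subset_leq_card/subsetP => -[r' z].
  rewrite !inE /= => /and3P[rA' zB i]; rewrite rA' zB i /=.
  case: eqVneq => [E|//] /=; apply/imsetP; exists z; rewrite ?E //.
  by rewrite inE zB -E.
(* By minimality an element with few neighbours could be removed: the weight it carries in the
   potential, [2 * s] here and [4 * w] for elements of [A'], is a bound that its degree must
   exceed. *)
have degB z : z \in B' -> 2 * s < #|nb1 z|.
  move=> zB; rewrite ltnNge; apply/negP => le.
  have c := cardsD1 z B'; rewrite zB add1n in c.
  have := minS A' (B' :\ z) (subxx _) (subsetDl _ _) sA'; have := incB z zB.
  rewrite c => i1 /(_ _) h; have {h} := h ltac:(lia).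
  by move: pot; rewrite c mulnS -addnA => pot /(drop_one pot i1 le).
have B0 : B' != set0.
  apply: contraTneq pot => ->; rewrite cards0 muln0 add0n -leqNgt.
  have -> : incidences A' set0 = set0 by apply/setP => a; rewrite !inE andbF.
  by rewrite cards0; nia.
have cA' : 2 * s < #|A'|.
  have [z zB] := set0Pn _ B0; apply: leq_trans (degB z zB) _; apply: subset_leq_card.
  by apply/subsetP => r; rewrite inE => /andP[].
have degA r : r \in A' -> 4 * w < #|nb2 r|.
  move=> rA; rewrite ltnNge; apply/negP => le.
  have c := cardsD1 r A'; rewrite rA add1n in c.
  have := minS (A' :\ r) B' (subsetDl _ _) (subxx _); have := incA r rA => i1 h.
  have {h} := h ltac:(lia) ltac:(lia).
  by move: pot; rewrite c mulnS addnCA => pot /(drop_one pot i1 le).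
exists A', B'; split=> //; first exact: ltnW.
  move=> r rA; have : 0 < #|nb2 r| by apply: leq_trans (degA r rA).
  by rewrite card_gt0 => /set0Pn[z]; rewrite inE => /andP[zB i]; exists z.
  move=> z zB; have : 0 < #|nb1 z| by apply: leq_trans (degB z zB).
  by rewrite card_gt0 => /set0Pn[r]; rewrite inE => /andP[rA i]; exists r.
move=> X Y cXY.
have cY : #|Y| <= 4 * w.
  by apply: leq_trans (leq_addl #|X| _) (leq_trans (ltnW cXY) _); rewrite leq_mul2r orbT.
have s2 : s <= 2 * s by rewrite leq_pmull.
move=> r0 r1 /setDP[r0A r0X] /setDP[r1A r1X]; apply: contraT => ncon.
pose E := share (A' :\: X) (B' :\: Y).
pose D := [set r in A' :\: X | connect E r0 r].
have Esym : connect_sym E by apply/sym_connect_sym/share_sym.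
have stepE r r' z : r \in A' -> r \notin X -> r' \in A' -> r' \notin X -> z \in B' ->
    z \notin Y -> I r z -> I r' z -> connect E r r'.
  move=> rA rX rA' rX' zB zY i i'; apply: connect1; rewrite /E /share /= !inE rA rX rA' rX' /=.
  by apply/exists_inP; exists z; rewrite ?inE ?zY ?i.
(* The two sides share exactly the deleted elements [X] and [Y], so every incidence lies within one
   of them. *)
pose A1 := D :|: (A' :&: X); pose A2 := A' :\: D.
pose B1 := [set z in B' | (z \in Y) || [exists r in D, I r z]].
pose B2 := [set z in B' | (z \in Y) || ~~ [exists r in D, I r z]].
have A1A : A1 \subset A' by apply/subsetP => r; rewrite !inE => /orP[/andP[/andP[]]|/andP[]].
have A2A : A2 \subset A' by apply: subsetDl.
have B1B : B1 \subset B' by apply/subsetP => z; rewrite inE => /andP[].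
have B2B : B2 \subset B' by apply/subsetP => z; rewrite inE => /andP[].
have r0D : r0 \in D by rewrite !inE r0A r0X /= connect0.
have r1D : r1 \notin D by rewrite inE (negPf ncon) andbF.
have far r : r \in A' -> r \notin X -> exists z, [/\ z \in B', z \notin Y & I r z].
  move=> rA rX; have lt : #|Y| < #|nb2 r| by apply: leq_ltn_trans (degA r rA).
  have /set0Pn[z] : nb2 r :\: Y != set0.
    by apply: contraTneq lt => /eqP; rewrite setD_eq0 -leqNgt => /subset_leq_card.
  by rewrite !inE => /and3P[zY zB i]; exists z.
(* [r0] has more than [4 * w >= #|Y|] neighbours, so one of them is outside [Y]; its more than
   [2 * s] neighbours are in [X] or in the component of [r0]. *)
have sA1 : s <= #|A1|.
  have [z [zB zY i]] := far r0 r0A r0X; have h := degB z zB.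
  have : #|nb1 z| <= #|A1|; last exact: leq_trans (leq_trans s2 (ltnW h)).
  apply/subset_leq_card/subsetP => r; rewrite !inE => /andP[rA ir]; rewrite rA /=.
  by case: (boolP (r \in X)) => //= rX; rewrite orbF (stepE _ _ z).
have sA2 : s <= #|A2|.
  have [z [zB zY i]] := far r1 r1A r1X; have h := degB z zB.
  have : #|nb1 z| <= #|A2|; last exact: leq_trans (leq_trans s2 (ltnW h)).
  apply/subset_leq_card/subsetP => r; rewrite !inE => /andP[rA ir]; rewrite rA /= !andbT.
  apply: contra ncon => /andP[rX c]; apply: connect_trans c _.
  by apply: (stepE _ _ z).
have c1 : #|A1| + #|A2| = #|A'| + #|A' :&: X|.
  have u : A1 :|: A2 = A'.
    apply/setP => r; rewrite !inE.
    by case: (r \in A'); case: (r \in X); case: (connect E r0 r).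
  have i : A1 :&: A2 = A' :&: X.
    apply/setP => r; rewrite !inE.
    by case: (r \in A'); case: (r \in X); case: (connect E r0 r).
  by rewrite -cardsUI u i.
have c2 : #|B1| + #|B2| = #|B'| + #|B' :&: Y|.
  have u : B1 :|: B2 = B'.
    apply/setP => z; rewrite !inE.
    by case: (z \in B'); case: (z \in Y); case: [exists _ in _, _].
  have i : B1 :&: B2 = B' :&: Y.
    apply/setP => z; rewrite !inE.
    by case: (z \in B'); case: (z \in Y); case: [exists _ in _, _].
  by rewrite -cardsUI u i.
have einc : #|incidences A' B'| <= #|incidences A1 B1| + #|incidences A2 B2|.
  apply: leq_trans (leq_card_setU _ _); apply/subset_leq_card/subsetP => -[r z].
  rewrite !inE /= => /and3P[rA zB i]; rewrite rA zB i /= !andbT.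
  case: (boolP (r \in X)) => /= rX; first by case: (z \in Y); case: [exists _ in _, _].
  case: (boolP (connect E r0 r)) => /= cr; rewrite ?orbF ?andbT.
    by apply/orP; right; apply/exists_inP; exists r; rewrite // !inE rA rX.
  case: (boolP (z \in Y)) => //= zY; apply/exists_inP => -[r' r'D i'].
  move: r'D; rewrite !inE => /andP[/andP[rX' rA'] c']; move/negP: cr; apply.
  by apply: connect_trans c' _; apply: (stepE _ _ z).
have lX : #|A' :&: X| <= #|X| by rewrite subset_leq_card ?subsetIr.
have lY : #|B' :&: Y| <= #|Y| by rewrite subset_leq_card ?subsetIr.
have p1 : #|A1| < #|A'|.
  apply: proper_card; apply/properP; split=> //; exists r1; rewrite // !inE r1A (negPf r1X) /=.
  by rewrite orbF.
have p2 : #|A2| < #|A'|.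
  by apply: proper_card; apply/properP; split=> //; exists r0; rewrite // inE r0D.
have q1 : #|B1| <= #|B'| by apply: subset_leq_card.
have q2 : #|B2| <= #|B'| by apply: subset_leq_card.
have m1 := minS A1 B1 A1A B1B sA1 (leq_add p1 q1).
have m2 := minS A2 B2 A2A B2B sA2 (leq_add p2 q2).
by case: (split_count w0 ws einc c1 c2 (leq_ltn_trans (leq_add lX lY) cXY) m1 m2 pot).
Qed.
End Bipartite.

Lemma sub_connect0 (T : finType) (e : rel T) x y :
  connect (avoid e set0) x y -> connect e x y.
Proof. by apply: connect_sub => u v /and3P[_ _ uv]; apply: connect1. Qed.

Section Slots.
Variables (V : finType) (G : graph V) (U W : {set V}) (p : nat) (R : 'I_p -> seq V).
Hypothesis Rp : forall i, path_between G U W (R i).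
Hypothesis Rd : pairwise_disjoint R.

Definition in_band (f f' : 'I_p -> nat) (r : 'I_p) (v : V) : bool :=
  (v \in R r) && (f r <= index v (R r) < f' r).

(* [cluster_robust]: fewer than [w] vertices [X] cannot separate from each other the strands
   of [RS] whose band avoids [X]. *)
Record cluster (w s : nat) (f f' : 'I_p -> nat) (RS : {set 'I_p}) (VC : {set V}) : Prop := {
  cluster_card : 2 * s <= #|RS|;
  cluster_gap : {in RS, forall r, (f r).+1 < f' r};
  cluster_strand : {in RS, forall r v, in_band f f' r v -> v \in VC};
  cluster_band : forall v, v \in VC -> exists r, in_band f f' r v;
  cluster_reach : forall v, v \in VC -> exists r x,
    [/\ r \in RS, in_band f f' r x & connect (induced_adj G VC) v x];
  cluster_robust : forall X : {set V}, #|X| < w -> {in RS &, forall r r',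
    (forall v, in_band f f' r v -> v \notin X) ->
    (forall v, in_band f f' r' v -> v \notin X) ->
    forall x y, in_band f f' r x -> in_band f f' r' y ->
      connect (avoid (induced_adj G VC) X) x y}
}.

Lemma strand_connect (S X : {set V}) r a b x y :
  (forall v, v \in R r -> a <= index v (R r) < b -> v \in S /\ v \notin X) ->
  x \in R r -> a <= index x (R r) < b -> y \in R r -> a <= index y (R r) < b ->
  connect (avoid (induced_adj G S) X) x y.
Proof.
move=> H; have csym : connect_sym (avoid (induced_adj G S) X).
  apply: sym_connect_sym => u v; rewrite /avoid /= andbCA; do 2 congr (_ && _).
  exact: induced_sym.
suff up k u v : u \in R r -> a <= index u (R r) < b -> v \in R r ->
    a <= index v (R r) < b -> index v (R r) = index u (R r) + k ->
    connect (avoid (induced_adj G S) X) u v.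
  move=> xR xb yR yb; case: (leqP (index x (R r)) (index y (R r))) => le.
    by apply: (up _ _ _ xR xb yR yb (esym (subnKC le))).
  by rewrite csym; apply: (up _ _ _ yR yb xR xb (esym (subnKC (ltnW le)))).
move=> uR /andP[lo hi]; elim: k v => [|k IH] v vR vb E.
  by rewrite addn0 in E; rewrite -(nth_index u uR) -E (nth_index u vR) connect0.
have [lo' hi'] := andP vb.
have ks : index u (R r) + k < size (R r).
  by apply: leq_trans (index_size v (R r)); rewrite E addnS.
pose c := nth u (R r) (index u (R r) + k).
have ic : index c (R r) = index u (R r) + k by rewrite index_uniq ?(linkage_uniq Rp).
have cR : c \in R r by rewrite mem_nth.
have cb : a <= index c (R r) < b.
  rewrite ic; apply/andP; split; first exact: leq_trans lo (leq_addr _ _).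
  by apply: leq_trans hi'; rewrite E addnS.
apply: connect_trans (IH c cR cb ic) _; apply: connect1.
have [cV cX] := H c cR cb; have [vV vX] := H v vR vb.
rewrite /avoid /= cX vX /induced_adj /= cV vV /=.
have -> : v = nth u (R r) (index u (R r) + k).+1 by rewrite -addnS -E nth_index.
move/(sortedP u): (linkage_sorted Rp r); apply.
by rewrite -addnS -E index_mem.
Qed.

Variables (m : nat) (P : 'I_m -> seq V) (J : {set 'I_m}).
Hypothesis Ps : forall j, sorted (adj G) (P j).
Hypothesis Pu : forall j, uniq (P j).
Hypothesis Pd : forall i j, i != j -> [disjoint P i & P j].
Hypothesis PR : forall j a b, consecutive (P j) a b -> exists r, a \in R r.

Variables (f f' : 'I_p -> nat).

(** Strict at both ends, unlike [in_band]: by safety, a path edge leaving the interior ends exactly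
    on one of the two frontiers. *)
Definition interior (v : V) : bool :=
  [exists r, (v \in R r) && (f r < index v (R r) < f' r)].

Definition first_in (j : 'I_m) : bool :=
  [exists v, [&& v \in P j, index v (P j) == 0 & interior v]].

Hypotheses (vf : valid R f) (vf' : valid R f').
Hypotheses (sf : safe G R f) (sf' : safe G R f').

Let on_J v := [exists j in J, v \in P j].

Let padj : rel V := [rel u v | [&& interior u, interior v & [exists j in J, consecutive (P j) u v]]].

Let padj_sym : connect_sym padj.
Proof.
apply: sym_connect_sym => u v; rewrite /padj /= andbCA; do 2 congr (_ && _).
by apply: eq_existsb => j; rewrite consecutive_sym.
Qed.

Let piece v := fingraph.root padj v.

Let connect_P u v j : connect padj u v -> u \in P j -> v \in P j.
Proof.
case/connectP => s; elim: s u => [u _ -> //|x s IH] u /= /andP[ux xs] vE uj.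
apply: IH xs vE _; case/and3P: ux => _ _ /exists_inP[j' _ /mem_consecutive[uj' xj']].
by rewrite (family_inj Pd uj uj').
Qed.

Let connect_int u v : connect padj u v -> interior u -> interior v.
Proof.
case/connectP => s; elim: s u => [u _ -> //|x s IH] u /= /andP[ux xs] vE uj.
by apply: IH xs vE _; case/and3P: ux.
Qed.

(** A piece is a component of the path edges inside the slot, represented by its canonical root. *)
Let pieces := [set z | [&& interior z, on_J z & piece z == z]].

Let interiorP r v : interior v -> v \in R r -> f r < index v (R r) < f' r.
Proof. by case/existsP => r' /andP[vr' h] vr; rewrite (linkage_inj Rd vr vr'). Qed.

Lemma nth_consecutive (x0 : V) s i : i.+1 < size s -> consecutive s (nth x0 s i) (nth x0 s i.+1).
Proof.
move=> lt; apply/orP; left; apply/infixP; exists (take i s), (drop i.+2 s).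
rewrite -{1}(cat_take_drop i s); congr (_ ++ _).
by rewrite (drop_nth x0) ?(ltnW lt) // (drop_nth x0).
Qed.

Let bag := [set u | [exists r, (u \in R r) && ((index u (R r) == f r) || (index u (R r) == f' r))]].

Let card_bag : #|bag| <= 2 * p.
Proof.
pose g (h : 'I_p -> nat) (r : 'I_p) := if R r is x :: _ then Some (nth x (R r) (h r)) else None.
have cg h : #|g h @: 'I_p| <= p by rewrite -[leqRHS]card_ord leq_imset_card.
rewrite mul2n -addnn -(@card_imset _ _ Some bag) => [|? ? []//].
apply: leq_trans (leq_add (cg f) (cg f')); apply: leq_trans (leq_card_setU _ _).
apply/subset_leq_card/subsetP => _ /imsetP[u uB ->]; move: uB; rewrite !inE.
have E r x : u \in R r -> g x r = Some (nth u (R r) (x r)) \/ size (R r) <= x r.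
  rewrite /g => ur; case ER: (R r) ur => [//|y t] ur.
  by case: (ltnP (x r) (size (y :: t))) => lt; [left; congr Some; apply: set_nth_default|right].
case/existsP => r /andP[ur /orP[] /eqP iu]; apply/orP; [left|right]; apply/imsetP; exists r => //.
  by case: (E r f ur) => [->|]; [rewrite -iu nth_index | rewrite leqNgt vf].
by case: (E r f' ur) => [->|]; [rewrite -iu nth_index | rewrite leqNgt vf'].
Qed.

Let firsts := [set j in J | first_in j].

Let starts0 := [set v | interior v && [exists j in J, (v \in P j) && (index v (P j) == 0)]].

Let card_starts0 : #|starts0| <= #|firsts|.
Proof.
pose h v := [pick j | (j \in J) && (v \in P j)].
have hE v j : j \in J -> v \in P j -> h v = Some j.
  move=> jJ vj; rewrite /h; case: pickP => [j' /andP[_ vj']|/(_ j)].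
    by rewrite (family_inj Pd vj vj').
  by rewrite jJ vj.
rewrite -(@card_in_imset _ _ h starts0) -?(@card_imset _ _ Some firsts) => [|? ? []//|].
  apply/subset_leq_card/subsetP => _ /imsetP[v vS ->]; move: vS; rewrite inE.
  case/andP=> vi /exists_inP[j jJ /andP[vj i0]]; rewrite (hE v j) // imset_f // inE jJ.
  by apply/existsP; exists v; rewrite vj i0.
move=> u v; rewrite !inE => /andP[_ /exists_inP[j jJ /andP[uj iu]]].
move=> /andP[_ /exists_inP[j' jJ' /andP[vj iv]]]; rewrite (hE u j) // (hE v j') // => -[E].
rewrite -E in vj iv; rewrite -(nth_index u uj) -(nth_index u vj).
by rewrite (eqP iu) (eqP iv).
Qed.

Let starts1 := [set v | [exists u in bag,
  [exists j, [&& u \in P j, v \in P j & index v (P j) == (index u (P j)).+1]]]].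

Let card_starts1 : #|starts1| <= 2 * p.
Proof.
pose nxt u := if [pick j | u \in P j] is Some j then nth u (P j) (index u (P j)).+1 else u.
apply: leq_trans card_bag; apply: leq_trans (leq_imset_card nxt bag).
apply/subset_leq_card/subsetP => v; rewrite inE => /exists_inP[u ub /existsP[j /and3P[uj vj /eqP iv]]].
apply/imsetP; exists u => //; rewrite /nxt; case: pickP => [j' uj'|/(_ j)]; last by rewrite uj.
by rewrite -(family_inj Pd uj uj') -iv nth_index.
Qed.

(** A piece is charged to its earliest vertex [u] on its path. Either [u] is the first vertex of the
    path, or its predecessor is not interior to the slot; the predecessor lies on a strand by [PR],
    and safety of [f] and [f'] then puts it on a frontier. Each of the at most [2 * p] frontier
    vertices has one successor on its path. *)
Let card_pieces : #|pieces| <= #|firsts| + 2 * p.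
Proof.
apply: leq_trans (leq_add card_starts0 card_starts1).
apply: leq_trans (leq_card_setU _ _); apply: leq_trans (leq_imset_card piece _).
apply/subset_leq_card/subsetP => z; rewrite inE => /and3P[zi /exists_inP[j jJ zj] /eqP rz].
have [u zu umin] := @arg_minnP _ z (connect padj z) (fun u => index u (P j)) (connect0 _ z).
apply/imsetP; exists u; last by rewrite -{1}rz; apply/eqP; rewrite (root_connect padj_sym).
have uj := connect_P zu zj; have ui := connect_int zu zi.
rewrite 2!inE ui /=; have [i0|i0] := eqVneq (index u (P j)) 0.
  by apply/orP; left; apply/exists_inP; exists j; rewrite // uj i0.
apply/orP; right; rewrite inE; set k := (index u (P j)).-1.
have kE : k.+1 = index u (P j) by rewrite prednK // lt0n.
have ks : k.+1 < size (P j) by rewrite kE index_mem.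
have := nth_consecutive u ks; rewrite kE nth_index // => cons.
set t := nth u (P j) k in cons.
have tj : t \in P j by rewrite mem_nth // ltnW.
have it : index t (P j) = k by rewrite index_uniq ?Pu // ltnW.
apply/exists_inP; exists t; last by apply/existsP; exists j; rewrite uj tj it kE eqxx.
have [r tr] := PR cons; have tu : adj G t u := sorted_consecutive (Ps j) cons.
have /existsP[r0 /andP[ur0 /andP[lo hi]]] := ui.
have nint : ~~ interior t.
  apply/negP => ti; have : index u (P j) <= index t (P j).
    apply: umin; apply: connect_trans zu _; apply: connect1.
    by rewrite /padj /= ui ti; apply/exists_inP; exists j; rewrite // consecutive_sym.
  by rewrite it -kE ltnn.
rewrite inE; apply/existsP; exists r; rewrite tr /=.
have ge : f r <= index t (R r).
  by rewrite leqNgt; apply/negP => lt; have := sf tr ur0 tu lt; rewrite leqNgt lo.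
have le : index t (R r) <= f' r.
  by apply: (sf' ur0 tr) => //; rewrite adj_sym.
apply: contraR nint; rewrite negb_or => /andP[n1 n2]; apply/existsP; exists r.
by rewrite tr !ltn_neqAle ge le eq_sym n1 n2.
Qed.

Let meets (r : 'I_p) z := [exists v, [&& v \in R r, interior v, on_J v & piece v == z]].

(** At most one pair per strand has its first meeting on [f] itself. The other new pairs map
    injectively to pairs of a strand and a piece, because a piece determines its path. *)
Lemma hits_between : #|hits_before R P J f'| <=
  #|hits_before R P J f| + p + #|incidences meets [set: 'I_p] pieces|.
Proof.
pose at_f := [set a : 'I_p * 'I_m | hits R P a.1 a.2 && (hit_index R P a.1 a.2 == f a.1)].
have cat : #|at_f| <= p.
  rewrite -[leqRHS]card_ord -(@card_in_imset _ _ fst at_f); first exact: max_card.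
  move=> [r1 j1] [r2 j2]; rewrite !inE /= => /andP[h1 /eqP c1] /andP[h2 /eqP c2] E.
  rewrite -E in h2 c2 *; congr (_, _).
  by apply: (hit_index_inj Pd h1 h2); rewrite c1 c2.
pose mid := [set a : 'I_p * 'I_m | [&& a.2 \in J, hits R P a.1 a.2 &
   f a.1 < hit_index R P a.1 a.2 < f' a.1]].
have cmid : #|mid| <= #|incidences meets [set: 'I_p] pieces|.
  have ex (a : 'I_p * 'I_m) : exists v, a \in mid -> [&& v \in R a.1, v \in P a.2, interior v & a.2 \in J].
    case: (boolP (a \in mid)) => [|_]; last first.
      by case: (R a.1) (Rp a.1) => // x s _; exists x.
    rewrite inE => /and3P[aJ h /andP[lo hi]]; have /hasP[x0 x0R _] := h.
    have lt : hit_index R P a.1 a.2 < size (R a.1) by rewrite /hit_index -has_find.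
    exists (nth x0 (R a.1) (hit_index R P a.1 a.2)) => _; rewrite mem_nth //.
    rewrite (nth_find x0 h) aJ andbT /=; apply/existsP; exists a.1.
    by rewrite mem_nth // index_uniq ?(linkage_uniq Rp) // lo hi.
  have [h hP] := fin_all_exists ex.
  rewrite -(@card_in_imset _ _ (fun a => (a.1, piece (h a))) mid).
    apply/subset_leq_card/subsetP => _ /imsetP[a /hP /and4P[vR vP vi aJ] ->].
    have hr : connect padj (h a) (piece (h a)) by apply: connect_root.
    rewrite !inE /= (connect_int hr vi) /piece (root_root padj_sym) eqxx /= andbT.
    apply/andP; split; first by apply/exists_inP; exists a.2; rewrite // (connect_P hr).
    apply/existsP; exists (h a); rewrite vR vi eqxx !andbT /=.
    by apply/exists_inP; exists a.2.
  move=> a b /hP /and4P[aR aP _ _] /hP /and4P[bR bP _ _] [E1 E2].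
  have cab : connect padj (h a) (h b).
    by rewrite -(root_connect padj_sym); apply/eqP.
  have E3 := family_inj Pd (connect_P cab aP) bP.
  by case: (a) (b) E1 E3 => [? ?] [? ?] /= -> ->.
apply: leq_trans (leq_add (leq_add (leqnn _) cat) cmid).
apply: leq_trans _ (leq_add (leq_card_setU _ _) (leqnn _)).
apply: leq_trans _ (leq_card_setU _ _); apply/subset_leq_card/subsetP => -[r j].
rewrite !inE /= => /and3P[-> -> ->] /=; rewrite andbT.
by case: ltngtP.
Qed.

Let pconnect_robust (VC X : {set V}) z u v :
  (forall x, interior x -> on_J x -> piece x = z -> x \in VC /\ x \notin X) ->
  interior u -> on_J u -> piece u = z -> connect padj u v ->
  connect (avoid (induced_adj G VC) X) u v.
Proof.
move=> H ui uJ uz /connectP[t]; elim: t u ui uJ uz => [|x t IH] u ui uJ uz /=.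
  by move=> _ ->; apply: connect0.
case/andP => ux tx vE; have /and3P[_ xi /exists_inP[j jJ cj]] := ux.
have xJ : on_J x by apply/exists_inP; exists j; have [] := mem_consecutive cj.
have xz : piece x = z.
  by rewrite -uz; apply/esym/eqP; rewrite (root_connect padj_sym) connect1.
have [uV uX] := H u ui uJ uz; have [xV xX] := H x xi xJ xz.
apply: connect_trans (IH x xi xJ xz tx vE); apply: connect1.
by rewrite /avoid /= uX xX /induced_adj /= uV xV (sorted_consecutive (Ps j) cj).
Qed.

(** The cluster consists of the bands of the strands and the vertices of the pieces in a robust
    subpair. A vertex lies in at most one band and one piece, so fewer than [w] vertices destroy
    fewer than [2 * w] elements of the subpair; the surviving bands and pieces are connected and
    avoid these vertices. *)
Lemma slot_cluster w s N : 0 < w -> 2 * w <= s -> s <= p -> #|firsts| <= N ->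
  #|hits_before R P J f| + p + (2 * s * (N + 2 * p) + 4 * w * p) <= #|hits_before R P J f'| ->
  exists RS VC, cluster w s f f' RS VC.
Proof.
move=> w0 ws sp cN ch.
have [||A' [B' [[_ BB] cA deg deg' rob]]] :=
    @robust_subpair _ _ meets [set: 'I_p] pieces s w w0 ws.
- by rewrite cardsT card_ord.
- have := leq_trans ch hits_between; rewrite leq_add2l; apply: leq_trans.
  rewrite cardsT card_ord leq_add2r leq_mul2l; apply/orP; right.
  by apply: leq_trans card_pieces _; rewrite leq_add2r.
pose VC := [set v | [exists r in A', in_band f f' r v] ||
                    [&& interior v, on_J v & piece v \in B']].
exists A', VC; split=> //.
- move=> r rA; have [z zB /existsP[v /and4P[vR vi _ _]]] := deg r rA.
  by have /andP[lo hi] := interiorP vi vR; apply: leq_ltn_trans hi.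
- by move=> r rA v vb; rewrite inE; apply/orP; left; apply/exists_inP; exists r.
- move=> v; rewrite inE => /orP[/exists_inP[r _ vb]|/and3P[/existsP[r /andP[vR /andP[lo hi]]] _ _]].
    by exists r.
  by exists r; rewrite /in_band vR (ltnW lo).
- move=> v vV; have := vV; rewrite inE => /orP[/exists_inP[r rA vb]|/and3P[vi vJ vB]].
    by exists r, v; split=> //; apply: connect0.
  have [r rA /existsP[x /and4P[xR xi xJ /eqP xz]]] := deg' _ vB.
  exists r, x; split=> //; first by have /andP[lo hi] := interiorP xi xR; rewrite /in_band xR (ltnW lo).
  have vx : connect padj v x by rewrite -(root_connect padj_sym) eq_sym; apply/eqP.
  apply: sub_connect0 (@pconnect_robust VC set0 (piece v) v x _ vi vJ erefl vx).
  by move=> y yi yJ yz; rewrite !inE yi yJ yz vB orbT.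
move=> X cX r r' rA rA' rX rX' x y xb yb.
pose row x := [pick r | in_band f f' r x].
have rowE r0 v : in_band f f' r0 v -> row v = Some r0.
  move=> h; rewrite /row; case: pickP => [r1 h1|/(_ r0)]; last by rewrite h.
  by have /andP[v1 _] := h1; have /andP[v0 _] := h; rewrite (linkage_inj Rd v0 v1).
pose X1 := [set r0 | [exists v in X, in_band f f' r0 v]]; pose X2 := piece @: X.
have cX1 : #|X1| <= #|X|.
  rewrite -(@card_imset _ _ Some X1) => [|? ? []//]; apply: leq_trans (leq_imset_card row X).
  apply/subset_leq_card/subsetP => _ /imsetP[r0 r0X ->]; move: r0X; rewrite inE.
  by case/exists_inP => v vX /rowE <-; apply: imset_f.
have cX2 : #|X2| <= #|X| by apply: leq_imset_card.
have c12 : #|X1| + #|X2| < 2 * w.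
  by rewrite mul2n -addnn; apply: leq_ltn_trans (leq_add cX1 cX2) _; rewrite -addSn leq_add // ltnW.
have notX1 r0 : r0 \notin X1 -> forall v, in_band f f' r0 v -> v \notin X.
  rewrite inE => h v vb; apply: contra h => vX; apply/exists_inP; by exists v.
have X1r r0 : (forall v, in_band f f' r0 v -> v \notin X) -> r0 \notin X1.
  by move=> h; rewrite inE; apply/exists_inP => -[v vX /h]; rewrite vX.
have inVC r0 : r0 \in A' -> r0 \notin X1 -> forall v, in_band f f' r0 v -> v \in VC /\ v \notin X.
  move=> r0A r0X v vb; split; last exact: notX1 vb.
  by rewrite inE; apply/orP; left; apply/exists_inP; exists r0.
have int_band r0 v : v \in R r0 -> interior v -> in_band f f' r0 v.
  by move=> vR vi; have /andP[lo hi] := interiorP vi vR; rewrite /in_band vR (ltnW lo).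
have band_connect r0 u v : r0 \in A' -> r0 \notin X1 -> in_band f f' r0 u -> in_band f f' r0 v ->
    connect (avoid (induced_adj G VC) X) u v.
  move=> r0A r0X /andP[uR ub] /andP[vR vb]; apply: (strand_connect _ uR ub vR vb).
  by move=> q qR qb; apply: (inVC r0) => //; rewrite /in_band qR.
have cr : connect (share meets (A' :\: X1) (B' :\: X2)) r r'.
  by apply: rob; rewrite // inE ?rA ?rA' andbT; apply: X1r.
have rA1 : r \in A' :\: X1 by rewrite inE rA andbT; apply: X1r.
case/connectP: cr => t; elim: t r rA1 x xb {rA rX} => [|r1 t IH] r0 /setDP[r0A r0X] x xb /=.
  by move=> _ E; apply: (band_connect _ _ _ r0A r0X xb); rewrite -E.
case/andP=> /and3P[_ r1D /exists_inP[z /setDP[zB zX]]].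
case/andP=> /existsP[v0 /and4P[v0R v0i v0J /eqP v0z]] /existsP[v1 /and4P[v1R v1i v1J /eqP v1z]] tp tl.
apply: connect_trans (band_connect _ _ _ r0A r0X xb (int_band _ _ v0R v0i)) _.
apply: connect_trans (IH r1 r1D v1 (int_band _ _ v1R v1i) tp tl).
apply: (@pconnect_robust VC X z) => //; last first.
  by rewrite -(root_connect padj_sym); apply/eqP; rewrite -/(piece v0) -/(piece v1) v0z.
move=> v vi vJ vz; split; first by rewrite inE vi vJ vz zB orbT.
by apply: contra zX => vX; rewrite -vz imset_f.
Qed.
End Slots.

Lemma sum_card_disjoint (T I : finType) (Q : pred I) (X : {set T}) (B : I -> {set T}) :
  (forall k, Q k -> B k \subset X) ->
  (forall k k' x, Q k -> Q k' -> x \in B k -> x \in B k' -> k = k') ->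
  \sum_(k | Q k) #|B k| <= #|X|.
Proof.
move=> BX Bd; rewrite -sum1_card; under eq_bigr => k Qk.
  rewrite -sum1_card (bigID (mem X)) /= [X in _ + X]big1 ?addn0; last first.
    by move=> x /andP[xB /negP[]]; apply: (subsetP (BX k Qk)).
  rewrite (eq_bigl (fun x => (x \in X) && (x \in B k))); last by move=> x; rewrite andbC.
  rewrite big_mkcondr /=.
over.
rewrite exchange_big /=; apply: leq_sum => x xX.
case: (pickP [pred k | Q k && (x \in B k)]) => [k /= /andP[Qk xk]|none]; last first.
  by rewrite big1 // => k Qk; have := none k; rewrite /= Qk /= => ->.
rewrite (bigD1 k) //= xk big1 // => k' /andP[Qk' nk].
by case: ifP => // xk'; rewrite (Bd _ _ _ Qk' Qk xk' xk) eqxx in nk.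
Qed.

(** * Joined clusters *)

Section Chains.
Variables (V : finType) (G : graph V) (U W : {set V}) (p : nat) (R : 'I_p -> seq V).
Hypothesis Rp : forall i, path_between G U W (R i).
Hypothesis Rd : pairwise_disjoint R.
Variables (w s M : nat) (F : nat -> 'I_p -> nat).
Hypothesis Fvalid : forall i, i <= M -> valid R (F i).
Hypothesis Fmono : forall i i', i <= i' <= M -> forall r, F i r <= F i' r.
Variables (D : {set 'I_M}) (RS : nat -> {set 'I_p}) (VC : nat -> {set V}).
Hypothesis cl : forall i : 'I_M, i \in D -> cluster G R w s (F i) (F i.+1) (RS i) (VC i).

(** Exits are the last vertices of the bands, hence the successor in the test, and entries are the
    first ones. Both belong to their clusters, while [between] starts after slot [i] and stops
    before slot [j]. *)
Definition exits i := [set v | [exists r in RS i, (v \in R r) && ((index v (R r)).+1 == F i.+1 r)]].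
Definition entries j := [set v | [exists r in RS j, (v \in R r) && (index v (R r) == F j r)]].
Definition between i j := [set v | [exists r, (v \in R r) && (F i.+1 r <= index v (R r) < F j r)]].
Definition region i j := exits i :|: between i j :|: entries j.

Definition joined (i j : nat) : bool :=
  (i < j) && [forall X : {set V}, (#|X| < w) ==>
    ~~ separates (induced_adj G (region i j)) (exits i) (entries j) X].

Lemma joined_paths i j : joined i j -> exists Q : 'I_w -> seq V,
  (forall k, link (induced_adj G (region i j)) (exits i) (entries j) (Q k)) /\
  (forall k k', k != k' -> [disjoint Q k & Q k']).
Proof.
case/andP=> _ /forallP H; apply: menger => X sX; rewrite leqNgt; apply/negP => lt.
by have := H X; rewrite lt sX.
Qed.

Let vertex_at r a : a < size (R r) -> exists2 v, v \in R r & index v (R r) = a.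
Proof.
case ER: (R r) => [//|x t] lt; exists (nth x (R r) a); first by rewrite -ER mem_nth ?ER.
by rewrite -ER index_uniq ?ER //; have := linkage_uniq Rp r; rewrite ER.
Qed.

Let card_rows (S : {set 'I_p}) (Y : {set V}) :
  (forall r, r \in S -> exists2 x, x \in Y & x \in R r) -> #|S| <= #|Y|.
Proof.
move=> H; have ex r : exists x, r \in S -> (x \in Y) && (x \in R r).
  case: (boolP (r \in S)) => [/H[x xY xR]|_]; first by exists x; rewrite xY xR.
  by case: (R r) (Rp r) => // x t _; exists x.
have [h hP] := fin_all_exists ex; rewrite -(@card_in_imset _ _ h S).
  by apply/subset_leq_card/subsetP => _ /imsetP[r /hP /andP[? _] ->].
move=> r r' /hP /andP[_ h1] /hP /andP[_ h2] E.
by apply: (linkage_inj Rd h1); rewrite E.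
Qed.

Section Separator.
Variables (i j : 'I_M) (X : {set V}).
Hypotheses (iD : i \in D) (jD : j \in D) (ij : i < j) (cX : #|X| < w).
Hypothesis sepX : separates (induced_adj G (region i j)) (exits i) (entries j) X.

Let F0 r : r \in RS i -> 0 < F i.+1 r.
Proof. by move=> rS; apply: leq_trans (cluster_gap (cl iD) rS). Qed.

Let no_connect r r' x y : r \in RS i -> r' \in RS j -> x \in R r -> y \in R r' ->
  (index x (R r)).+1 = F i.+1 r -> index y (R r') = F j r' -> x \notin X -> y \notin X ->
  connect (avoid (induced_adj G (region i j)) X) x y -> False.
Proof.
move=> rS r'S xR yR ix iy xX yX; apply/negP.
have := forall_inP (forall_inP sepX x _) y; apply; rewrite !inE ?xX ?yX /=.
  by apply/exists_inP; exists r; rewrite // xR ix eqxx.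
by apply/exists_inP; exists r'; rewrite // yR iy eqxx.
Qed.

Let in_region r v : v \in R r -> (r \in RS i) || (F i.+1 r <= index v (R r)) ->
  (r \in RS j) || (index v (R r) < F j r) ->
  (F i.+1 r).-1 <= index v (R r) < (F j r).+1 -> v \in region i j.
Proof.
move=> vR hi hj /andP[lo up]; rewrite !inE.
have [E|lo'] := ltnP (index v (R r)) (F i.+1 r).
  apply/orP; left; apply/orP; left; apply/exists_inP; exists r.
    by move: hi; rewrite leqNgt E orbF.
  by rewrite vR /=; apply/eqP; move: lo E; clear; lia.
have [up'|E] := ltnP (index v (R r)) (F j r).
  by apply/orP; left; apply/orP; right; apply/existsP; exists r; rewrite vR lo' up'.
apply/orP; right; apply/exists_inP; exists r; first by move: hj; rewrite ltnNge E orbF.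
by rewrite vR eqn_leq E -ltnS up.
Qed.

Lemma separator_hits_strand r : r \in RS i -> r \in RS j ->
  exists2 x, x \in X & (x \in R r) && ((F i.+1 r).-1 <= index x (R r) < (F j r).+1).
Proof.
move=> rI rJ; apply: NNPP => none.
have nX v : v \in R r -> (F i.+1 r).-1 <= index v (R r) < (F j r).+1 -> v \notin X.
  by move=> vR vb; apply/negP => vX; apply: none; exists v; rewrite ?vR.
have jM := ltnW (ltn_ord j); have hF : F i.+1 r <= F j r by apply: Fmono; rewrite ij.
have hs := Fvalid jM r; have h0 := F0 rI.
have [|x xR ix] := @vertex_at r (F i.+1 r).-1.
  by apply: leq_ltn_trans hs; apply: leq_trans hF; apply: leq_pred.
have [y yR iy] := @vertex_at r (F j r) hs.
have xb : (F i.+1 r).-1 <= index x (R r) < (F j r).+1.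
  by rewrite ix leqnn ltnS (leq_trans (leq_pred _) hF).
have yb : (F i.+1 r).-1 <= index y (R r) < (F j r).+1.
  by rewrite iy ltnSn andbT (leq_trans (leq_pred _) hF).
apply: (no_connect rI rJ xR yR) iy _ _ _.
- by rewrite ix prednK.
- exact: nX.
- exact: nX.
apply: (strand_connect Rp _ xR xb yR yb) => v vR vb; split; last exact: nX.
by apply: in_region vb; rewrite ?rI ?rJ.
Qed.

(** If [X] misses both segments, it misses the bands of [r] and [r'] in slot [k], and robustness of
    that cluster lets a walk change from [r] to [r'] there. *)
Lemma separator_hits_route (k : 'I_M) r r' : k \in D -> i < k -> k < j ->
  r \in RS i -> r \in RS k -> r' \in RS k -> r' \in RS j ->
  (exists2 x, x \in X & (x \in R r) && ((F i.+1 r).-1 <= index x (R r) < F k.+1 r)) \/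
  (exists2 x, x \in X & (x \in R r') && (F k r' <= index x (R r') < (F j r').+1)).
Proof.
move=> kD ik kj rI rK rK' rJ'; apply: NNPP => /not_or_and[n1 n2].
have nX1 v : v \in R r -> (F i.+1 r).-1 <= index v (R r) < F k.+1 r -> v \notin X.
  by move=> vR vb; apply/negP => vX; apply: n1; exists v; rewrite ?vR.
have nX2 v : v \in R r' -> F k r' <= index v (R r') < (F j r').+1 -> v \notin X.
  by move=> vR vb; apply/negP => vX; apply: n2; exists v; rewrite ?vR.
have jM := ltnW (ltn_ord j); have kM := ltnW (ltn_ord k).
have Fik q : F i.+1 q <= F k q by apply: Fmono; rewrite ik.
have Fkj q : F k.+1 q <= F j q by apply: Fmono; rewrite kj.
have Fkk q : F k q <= F k.+1 q by apply: Fmono; rewrite leqnSn ltn_ord.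
have g1 := cluster_gap (cl kD) rK; have g2 := cluster_gap (cl kD) rK'.
have h0 := F0 rI.
have [|x xR ix] := @vertex_at r (F i.+1 r).-1.
  apply: leq_ltn_trans (Fvalid kM r); apply: leq_trans (Fik r); exact: leq_pred.
have [x1 x1R ix1] := @vertex_at r (F k r) (Fvalid kM r).
have [y1 y1R iy1] := @vertex_at r' (F k r') (Fvalid kM r').
have [y yR iy] := @vertex_at r' (F j r') (Fvalid jM r').
have lo : (F i.+1 r).-1 <= F k r := leq_trans (leq_pred _) (Fik r).
have up : F k r' <= F j r' := leq_trans (Fkk r') (Fkj r').
have xb : (F i.+1 r).-1 <= index x (R r) < F k.+1 r.
  by rewrite ix leqnn (leq_ltn_trans lo) // ltnW.
have x1b : (F i.+1 r).-1 <= index x1 (R r) < F k.+1 r by rewrite ix1 lo ltnW.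
have y1b : F k r' <= index y1 (R r') < (F j r').+1 by rewrite iy1 leqnn ltnS.
have yb : F k r' <= index y (R r') < (F j r').+1 by rewrite iy up ltnSn.
apply: (no_connect rI rJ' xR yR) iy _ _ _.
- by rewrite ix prednK.
- exact: nX1.
- exact: nX2.
apply: (@connect_trans _ _ x1).
  apply: (strand_connect Rp _ xR xb x1R x1b) => v vR vb; split; last exact: nX1.
  have /andP[vlo vup] := vb; have vj := leq_trans vup (Fkj r).
  by apply: (in_region vR); rewrite ?rI ?vj ?orbT // vlo ltnW.
apply: (@connect_trans _ _ y1); last first.
  apply: (strand_connect Rp _ y1R y1b yR yb) => v vR vb; split; last exact: nX2.
  have /andP[vlo vup] := vb; have vi := leq_trans (Fik r') vlo.
  by apply: (in_region vR); rewrite ?rJ' ?vi ?orbT // vup (leq_trans (leq_pred _)).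
have VCr : VC k \subset region i j.
  apply/subsetP => v /(cluster_band (cl kD))[q /andP[vR /andP[vlo vup]]].
  rewrite !inE; apply/orP; left; apply/orP; right; apply/existsP; exists q.
  by rewrite vR (leq_trans (Fik q)) //= (leq_trans vup).
have lift : subrel (avoid (induced_adj G (VC k)) X) (connect (avoid (induced_adj G (region i j)) X)).
  move=> a b /and3P[aX bX /and3P[aV bV ab]]; apply: connect1.
  by rewrite /avoid /= aX bX /induced_adj /= !(subsetP VCr).
apply: (connect_sub lift); apply: (cluster_robust (cl kD) cX rK rK').
- move=> v /andP[vR /andP[vlo vup]]; apply: (nX1 _ vR).
  by rewrite vup (leq_trans lo).
- move=> v /andP[vR /andP[vlo vup]]; apply: (nX2 _ vR).
  by rewrite vlo (leq_trans vup) // leqW.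
- by rewrite /in_band x1R ix1 leqnn ltnW.
- by rewrite /in_band y1R iy1 leqnn ltnW.
Qed.
End Separator.

Section Unjoined.
Variable D' : {set 'I_M}.
Hypothesis DD : D' \subset D.
Hypothesis unj : {in D' &, forall i j : 'I_M, ~~ joined i j}.

Let separator (i j : 'I_M) : i \in D' -> j \in D' -> i < j -> exists2 X : {set V},
  #|X| < w & separates (induced_adj G (region i j)) (exits i) (entries j) X.
Proof.
move=> iD jD ij; have := unj iD jD; rewrite /joined ij /= negb_forall => /existsP[X].
by rewrite negb_imply negbK => /andP[cX sX]; exists X.
Qed.

(* [a i k] counts the strands on which the cluster [k] immediately follows the cluster
   [i]; if [i] and [j] are unjoined, fewer than [w] vertices block both these strands
   and the two-step routes through an intermediate cluster. *)
Let occ (i k : 'I_M) (r : 'I_p) := [&& i \in D', k \in D', i < k, r \in RS i, r \in RS k &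
  [forall l in D', (i < l < k) ==> (r \notin RS l)]].
Let a i k := #|[set r | occ i k r]|.

Let occP i k r : reflect ([/\ i \in D', k \in D', i < k, r \in RS i & r \in RS k] /\
    {in D', forall l : 'I_M, i < l < k -> r \notin RS l}) (occ i k r).
Proof.
apply: (iffP idP) => [|[[h1 h2 h3 h4 h5] n]].
  case/and5P=> h1 h2 h3 h4 /andP[h5 /forall_inP n]; split=> // l lD.
  exact: (implyP (n l lD)).
by apply/and5P; split=> //; rewrite h5; apply/forall_inP => l lD; apply/implyP/n.
Qed.

Let occ_inj1 i k k' r : occ i k r -> occ i k' r -> k = k'.
Proof.
case/occP=> -[_ kD ik _ rk] n /occP[[_ kD' ik' _ rk'] n'].
apply/val_inj/eqP => /=; case: ltngtP => // lt.
  by have := n' k kD; rewrite ik lt rk => /(_ isT).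
by have := n k' kD'; rewrite ik' lt rk' => /(_ isT).
Qed.

Let occ_inj2 i i' k r : occ i k r -> occ i' k r -> i = i'.
Proof.
case/occP=> -[iD _ ik ri _] n /occP[[iD' _ ik' ri' _] n'].
apply/val_inj/eqP => /=; case: ltngtP => // lt.
  by have := n i' iD'; rewrite ik' lt ri' => /(_ isT).
by have := n' i iD; rewrite ik lt ri => /(_ isT).
Qed.

Let a_le i k : a i k <= w.
Proof.
have [/eqP|[r]] := set_0Vmem [set r | occ i k r]; first by rewrite -cards_eq0 /a => /eqP ->.
rewrite inE => /occP[[iD kD ik _ _] _].
have [X cX sX] := separator iD kD ik; apply: leq_trans (ltnW cX); apply: card_rows => q.
rewrite inE => /occP[[_ _ _ qi qk] _].
have [x xX /andP[xR _]] := separator_hits_strand (subsetP DD _ iD) ik sX qi qk.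
by exists x.
Qed.

(** For each [k], the separator hits all [a i k] strands or all [a k j] strands on their segments,
    since one missed strand of each kind would give an open route. As all factors are at most [w],
    the product is at most [w] times the number of vertices used. Different [k] use different
    vertices, because the cluster following [i], or preceding [j], on a strand is unique. *)
Let two_step i j : \sum_(k in D') a i k * a k j <= 2 * w * w.
Proof.
have big0 : ~~ [&& i \in D', j \in D' & i < j] -> \sum_(k in D') a i k * a k j = 0.
  move=> nij; apply: big1 => k _.
  have [/eqP|[r]] := set_0Vmem [set r | occ i k r]; first by rewrite -cards_eq0 /a => /eqP ->.
  have [/eqP|[r']] := set_0Vmem [set r | occ k j r].
    by rewrite -cards_eq0 /a => /eqP ->; rewrite muln0.
  rewrite !inE => /occP[[_ jD kj _ _] _] /occP[[iD _ ik _ _] _].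
  by rewrite iD jD (ltn_trans ik kj) in nij.
case: (boolP [&& i \in D', j \in D' & i < j]) => [/and3P[iD jD ij]|/big0 -> //].
have [X cX sX] := separator iD jD ij.
pose ha k := [set x in X |
  [exists r, [&& occ i k r, x \in R r & (F i.+1 r).-1 <= index x (R r) < F k.+1 r]]].
pose hb k := [set x in X | [exists r, [&& occ k j r, x \in R r & F k r <= index x (R r) < (F j r).+1]]].
have cha : \sum_(k in D') #|ha k| <= #|X|.
  apply: sum_card_disjoint => [k _|k k' x _ _]; first by apply/subsetP => x; rewrite inE => /andP[].
  rewrite !inE => /andP[_ /existsP[r /and3P[o xR _]]] /andP[_ /existsP[r' /and3P[o' xR' _]]].
  by rewrite (linkage_inj Rd xR' xR) in o'; apply: occ_inj1 o o'.
have chb : \sum_(k in D') #|hb k| <= #|X|.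
  apply: sum_card_disjoint => [k _|k k' x _ _]; first by apply/subsetP => x; rewrite inE => /andP[].
  rewrite !inE => /andP[_ /existsP[r /and3P[o xR _]]] /andP[_ /existsP[r' /and3P[o' xR' _]]].
  by rewrite (linkage_inj Rd xR' xR) in o'; apply: occ_inj2 o o'.
have key k : k \in D' -> a i k * a k j <= w * #|ha k| + w * #|hb k|.
  move=> kD; have [le|lt] := leqP (a i k) #|ha k|.
    by apply: leq_trans (leq_addr _ _); rewrite mulnC leq_mul ?a_le.
  have [le|lt'] := leqP (a k j) #|hb k|.
    by apply: leq_trans (leq_addl _ _); rewrite leq_mul ?a_le.
  have [r [o nr]] : exists r, occ i k r /\ ~ exists2 x, x \in ha k & x \in R r.
    apply: NNPP => none; move: lt; rewrite ltnNge => /negP; apply.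
    by apply: card_rows => r; rewrite inE => o; apply: NNPP => nx; apply: none; exists r.
  have [r' [o' nr']] : exists r, occ k j r /\ ~ exists2 x, x \in hb k & x \in R r.
    apply: NNPP => none; move: lt'; rewrite ltnNge => /negP; apply.
    by apply: card_rows => r'; rewrite inE => o'; apply: NNPP => nx; apply: none; exists r'.
  have /occP[[_ _ ik ri rk] _] := o; have /occP[[_ _ kj rk' rj'] _] := o'.
  case: (separator_hits_route (subsetP DD _ iD) cX sX (subsetP DD _ kD) ik kj ri rk rk' rj').
    case=> x xX /andP[xR xb]; case: nr; exists x => //; rewrite inE xX /=.
    by apply/existsP; exists r; rewrite o xR xb.
  case=> x xX /andP[xR xb]; case: nr'; exists x => //; rewrite inE xX /=.
  by apply/existsP; exists r'; rewrite o' xR xb.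
apply: (@leq_trans (\sum_(k in D') (w * #|ha k| + w * #|hb k|))); first exact: leq_sum.
rewrite big_split /= -!big_distrr /= -mulnDr.
rewrite mulnC leq_mul2r mul2n -addnn; apply/orP; right.
exact: leq_trans (leq_add cha chb) (leq_add (ltnW cX) (ltnW cX)).
Qed.

Let x k := #|[set r | [exists i, occ i k r] && [exists j, occ k j r]]|.

Let x_sqr k : x k * x k <= (\sum_(i in D') a i k) * (\sum_(j in D') a k j).
Proof.
have swap (Q : 'I_M -> 'I_p -> bool) : (forall i r, Q i r -> i \in D') ->
    #|[set r | [exists i, Q i r]]| <= \sum_(i in D') #|[set r | Q i r]|.
  move=> QD; apply: leq_trans (_ : #|\bigcup_(i in D') [set r | Q i r]| <= _).
    apply/subset_leq_card/subsetP => r; rewrite inE => /existsP[i q].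
    by apply/bigcupP; exists i; rewrite ?inE // (QD _ _ q).
  elim/big_ind2: _ => [|n1 S1 n2 S2 h1 h2|//]; first by rewrite cards0.
  exact: leq_trans (leq_card_setU _ _) (leq_add h1 h2).
apply: leq_mul.
  apply: leq_trans (swap (occ^~ k) _) => [|i r /occP[[]]//].
  by apply/subset_leq_card/subsetP => r; rewrite !inE => /andP[].
apply: leq_trans (swap (occ k) _) => [|i r /occP[[]]//].
by apply/subset_leq_card/subsetP => r; rewrite !inE => /andP[].
Qed.

(** A strand lacks a predecessor only in the first cluster of [D'] using it and a successor only in
    the last one, so at most [2 * p] incidences are lost. *)
Let sum_x : #|D'| * (2 * s) <= \sum_(k in D') x k + 2 * p.
Proof.
pose y0 k := [set r in RS (k : 'I_M) | ~~ [exists i, occ i k r]].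
pose y1 k := [set r in RS (k : 'I_M) | ~~ [exists j, occ k j r]].
have c0 : \sum_(k in D') #|y0 k| <= p.
  rewrite -[leqRHS]card_ord -cardsT; apply: sum_card_disjoint => [k _|k k' r kD kD'].
    exact: subsetT.
  wlog lt : k k' kD kD' / k < k'.
    move=> H r1 r2; case: (ltngtP k k') => [lt|lt|/val_inj //]; first exact: H.
    by apply/esym; apply: H.
  rewrite !inE => /andP[rk _] /andP[rk' /negP[]].
  have P0 : [&& k \in D', k < k' & r \in RS k] by rewrite kD lt rk.
  have [l /and3P[lD lk' rl] lmax] := @arg_maxnP _ k
    (fun l : 'I_M => [&& l \in D', l < k' & r \in RS l]) val P0.
  apply/existsP; exists l; apply/occP; split=> // q qD /andP[lq qk']; apply/negP => rq.
  by have := lmax q; rewrite qD qk' rq => /(_ isT); rewrite /= leqNgt lq.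
have c1 : \sum_(k in D') #|y1 k| <= p.
  rewrite -[leqRHS]card_ord -cardsT; apply: sum_card_disjoint => [k _|k k' r kD kD'].
    exact: subsetT.
  wlog lt : k k' kD kD' / k < k'.
    move=> H r1 r2; case: (ltngtP k k') => [lt|lt|/val_inj //]; first exact: H.
    by apply/esym; apply: H.
  rewrite !inE => /andP[rk /negP nk] /andP[rk' _]; case: nk.
  have P0 : [&& k' \in D', k < k' & r \in RS k'] by rewrite kD' lt rk'.
  have [l /and3P[lD lk' rl] lmin] := @arg_minnP _ k'
    (fun l : 'I_M => [&& l \in D', k < l & r \in RS l]) val P0.
  apply/existsP; exists l; apply/occP; split=> // q qD /andP[kq ql]; apply/negP => rq.
  by have := lmin q; rewrite qD kq rq => /(_ isT); rewrite /= leqNgt ql.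
rewrite [2 * p]mul2n -addnn addnA.
apply: leq_trans (leq_add (leq_add (leqnn _) c0) c1); rewrite -!big_split /= -sum_nat_const.
apply: leq_sum => k kD; apply: leq_trans (cluster_card (cl (subsetP DD _ kD))) _.
apply: leq_trans _ (leq_add (leq_card_setU _ _) (leqnn _)).
apply: leq_trans _ (leq_card_setU _ _); apply/subset_leq_card/subsetP => r rk.
by rewrite !inE rk /=; case: [exists i, _]; case: [exists i, _].
Qed.

(** With [n = #|D'|], the sum of the [x k] is at least [s * n], so by
    [2 * s * x k <= x k * x k + s * s] their squares add up to at least [n * s * s]. But [x k * x k]
    is at most the number of ways in times the number of ways out, and summing [two_step] over all
    pairs bounds this by [n * n * (2 * w * w)]. *)
Lemma unjoined_card : 0 < #|D'| -> 2 * p <= s * #|D'| -> 2 * w * w * #|D'| < s * s -> False.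
Proof.
set n := #|D'| => n0 hp hw.
have up : \sum_(k in D') x k * x k <= n * (n * (2 * w * w)).
  apply: (@leq_trans (\sum_(k in D') (\sum_(i in D') a i k) * (\sum_(j in D') a k j))).
    by apply: leq_sum => k _; apply: x_sqr.
  have -> : \sum_(k in D') (\sum_(i in D') a i k) * (\sum_(j in D') a k j) =
      \sum_(i in D') \sum_(j in D') \sum_(k in D') a i k * a k j.
    under eq_bigr => k _ do rewrite big_distrl /=; rewrite exchange_big /=.
    apply: eq_bigr => i _; rewrite [RHS]exchange_big /=; apply: eq_bigr => k _.
    by rewrite big_distrr.
  rewrite -sum_nat_const; apply: leq_sum => i _; rewrite -sum_nat_const.
  by apply: leq_sum => j _; apply: two_step.
have lo : \sum_(k in D') (2 * s * x k) <= \sum_(k in D') (x k * x k + s * s).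
  apply: leq_sum => k _; have := nat_Cauchy (x k) s; rewrite -!mulnn => h.
  by case: h => h _; rewrite -mulnA (mulnC s (x k)).
rewrite big_split /= sum_nat_const -/n -big_distrr /= in lo.
have T := sum_x; rewrite -/n in T; move: T lo up; move: (\sum_(k in D') x k) (\sum_(k in D') x k * x k).
move=> T Q hT lo up; clear -n0 hp hw hT lo up.
have {}hT : s * n <= T by move: hT hp; rewrite mulnCA [n * s]mulnC; lia.
have h2 : 2 * s * (s * n) <= 2 * s * T by rewrite leq_mul2l hT orbT.
have h3 : n * (s * s) <= n * (n * (2 * w * w)) by move: h2 lo up; nia.
by move: h3; rewrite leq_mul2l; case/orP; [move/eqP|]; move: hw; nia.
Qed.
End Unjoined.
End Chains.

(** * Assembling the Path-of-Sets System *)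

Lemma subset_of_card (T : finType) (A : {set T}) n : n <= #|A| ->
  exists2 B : {set T}, B \subset A & #|B| = n.
Proof.
move=> nA; exists [set x in take n (enum A)].
  by apply/subsetP => x; rewrite inE => /mem_take; rewrite mem_enum.
rewrite cardsE; have /card_uniqP -> : uniq (take n (enum A)) by rewrite take_uniq ?enum_uniq.
by rewrite size_takel // -cardE.
Qed.

(** [S a] consists of the elements that end a chain of [a] links. Each round discards the elements
    without a predecessor in the current set; no two of them are linked, so fewer than [n] are
    lost. *)
Lemma chain_of_dense (T : finType) (D : {set T}) (lk : rel T) (n L : nat) : 0 < n ->
  (forall B : {set T}, B \subset D -> #|B| = n -> exists i j, [/\ i \in B, j \in B & lk i j]) ->
  L.+1 * n <= #|D| ->
  exists c : seq T, [/\ size c = L.+1, all [in D] c & sorted lk c].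
Proof.
move=> n0 dense; pose nxt (S : {set T}) := [set j in S | [exists i in S, lk i j]].
pose S a := iter a nxt D.
have SD a : S a \subset D.
  elim: a => [|a IH]; first exact: subxx.
  by apply: subset_trans IH; apply/subsetP => x; rewrite inE => /andP[].
have step a : #|S a| <= #|S a.+1| + n.
  rewrite leqNgt; apply/negP => lt.
  have sub : S a.+1 \subset S a by apply/subsetP => x; rewrite inE => /andP[].
  have : n <= #|S a :\: S a.+1|.
    by have := cardsID (S a.+1) (S a); rewrite (setIidPr sub); move: lt; clear; lia.
  case/subset_of_card => B BS cB.
  have [|i [j [iB jB ij]]] := dense B _ cB.
    by apply: subset_trans BS (subset_trans (subsetDl _ _) (SD a)).
  have /setDP[iS _] := subsetP BS i iB; have /setDP[jS /negP[]] := subsetP BS j jB.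
  by rewrite inE jS; apply/exists_inP; exists i.
have chain a j : j \in S a -> exists c : seq T, [/\ size c = a, all [in D] (rcons c j) & sorted lk (rcons c j)].
  elim: a j => [|a IH] j jS; first by exists [::]; rewrite /= (subsetP (SD 0)).
  have := jS; rewrite inE => /andP[_ /exists_inP[i iS ij]].
  have [c [sc ac oc]] := IH i iS; exists (rcons c i); split; first by rewrite size_rcons sc.
    by rewrite all_rcons /= ac (subsetP (SD a.+1)).
  by case: c oc {sc ac} => [|x c] /=; rewrite ?ij // !rcons_path last_rcons ij andbT.
have card a : #|D| <= #|S a| + a * n.
  elim: a => [|a IH]; first by rewrite addn0.
  by apply: leq_trans IH _; rewrite mulSn addnA leq_add2r.
move=> cD; have : 0 < #|S L|.
  by rewrite lt0n; apply/eqP => S0; have := leq_trans cD (card L); rewrite S0 mulSn; move: n0; clear; lia.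
case/card_gt0P => j /chain[c [sc ac oc]]; exists (rcons c j).
by rewrite size_rcons sc.
Qed.

Lemma path_induced (V : finType) (G : graph V) (S : {set V}) x s : x \in S ->
  path (induced_adj G S) x s -> {in x :: s, forall v, v \in S}.
Proof.
elim: s x => [|y s IH] x xS /=; first by move=> _ v; rewrite inE => /eqP ->.
case/andP=> /and3P[_ yS _] ys v; rewrite inE => /predU1P[-> //|]; exact: IH.
Qed.

Section Assembly.
Variables (V : finType) (G : graph V) (U W : {set V}) (p : nat) (R : 'I_p -> seq V).
Hypothesis Rp : forall i, path_between G U W (R i).
Hypothesis Rd : pairwise_disjoint R.
Variables (w s M : nat) (F : nat -> 'I_p -> nat).
Hypothesis Fvalid : forall i, i <= M -> valid R (F i).
Hypothesis Fmono : forall i i', i <= i' <= M -> forall r, F i r <= F i' r.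
Variables (D : {set 'I_M}) (RS : nat -> {set 'I_p}) (VC : nat -> {set V}).
Hypothesis cl : forall i : 'I_M, i \in D -> cluster G R w s (F i) (F i.+1) (RS i) (VC i).
Hypothesis w0 : 0 < w.
Hypothesis s0 : 0 < s.

Local Notation exits := (exits R F RS).
Local Notation entries := (entries R F RS).
Local Notation region := (region R F RS).

Lemma linkage_verts r v : v \in R r -> v \in verts G.
Proof.
case: (R r) (Rp r) => // x t /and3P[xG xt _].
elim: t x xG xt => [|y t IH] x xG /=; first by rewrite inE => _ /eqP ->.
case/andP=> xy yt; rewrite inE => /predU1P[-> //|]; apply: IH yt.
by move: xy; rewrite adj_sym => /adj_verts.
Qed.

Section OneCluster.
Variable i : 'I_M.
Hypothesis iD : i \in D.
Implicit Types T X : {set V}.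
Local Notation VCi := (VC i).

(** Covers sets of entries and sets of exits alike, so that a single linking lemma yields both
    well-linkedness conditions and the linkedness of entries with exits. *)
Definition transversal (T : {set V}) :=
  {in T, forall v, exists2 r, r \in RS i & in_band R (F i) (F i.+1) r v} /\
  {in T &, forall u v, forall r, u \in R r -> v \in R r -> u = v}.

Lemma index_eq r u v : u \in R r -> v \in R r -> index u (R r) = index v (R r) -> u = v.
Proof. by move=> uR vR E; rewrite -(nth_index u uR) E nth_index. Qed.

Lemma entries_transversal T : T \subset entries i -> transversal T.
Proof.
move=> /subsetP TS; split=> [v|u v] /TS; rewrite inE => /exists_inP[r rS /andP[vR /eqP iv]].
  by exists r; rewrite // /in_band vR iv leqnn ltnW // (cluster_gap (cl iD)).
move=> /TS; rewrite inE => /exists_inP[r' rS' /andP[vR' /eqP iv']] q uq vq.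
have E := linkage_inj Rd vR uq; have E' := linkage_inj Rd vR' vq.
by apply: (index_eq uq vq); rewrite -{1}E -E' iv iv' E E'.
Qed.

Lemma exits_transversal T : T \subset exits i -> transversal T.
Proof.
move=> /subsetP TS; split=> [v|u v] /TS; rewrite inE => /exists_inP[r rS /andP[vR /eqP iv]].
  exists r; rewrite // /in_band vR -iv ltnSn andbT.
  by have := cluster_gap (cl iD) rS; rewrite -iv ltnS => /ltnW.
move=> /TS; rewrite inE => /exists_inP[r' rS' /andP[vR' /eqP iv']] q uq vq.
have E := linkage_inj Rd vR uq; have E' := linkage_inj Rd vR' vq.
by apply: (index_eq uq vq); apply/succn_inj; rewrite -{1}E -E' iv iv' E E'.
Qed.

Lemma transversal_sub T : transversal T -> T \subset VCi.
Proof. by case=> h _; apply/subsetP => v /h[r rS vb]; apply: cluster_strand (cl iD) _ rS _ vb. Qed.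

Lemma cluster_verts : VCi \subset verts G.
Proof. by apply/subsetP => v /(cluster_band (cl iD))[r /andP[vR _]]; apply: linkage_verts vR. Qed.

(** The vertices of [T] lie on different strands, so [X] is too small to meet all their bands. *)
Lemma transversal_escape T (X : {set V}) : transversal T -> #|X| < #|T| ->
  exists r v, [/\ v \in T, r \in RS i, in_band R (F i) (F i.+1) r v &
    forall x, in_band R (F i) (F i.+1) r x -> x \notin X].
Proof.
move=> [tr inj] lt; apply: NNPP => none; move: lt; rewrite ltnNge => /negP; apply.
have ex v : exists x, v \in T -> x \in X /\ exists r, v \in R r /\ x \in R r.
  case: (boolP (v \in T)) => [vT|_]; last by exists v.
  have [r rS vb] := tr v vT; apply: NNPP => nx; apply: none; exists r, v; split=> // x xb.
  apply/negP => xX; apply: nx; exists x => _; split=> //; exists r.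
  by have /andP[-> _] := vb; have /andP[-> _] := xb.
have [h hP] := fin_all_exists ex; rewrite -(@card_in_imset _ _ h T).
  by apply/subset_leq_card/subsetP => _ /imsetP[v /hP[? _] ->].
move=> u v uT vT E; have [_ [r [ur hr]]] := hP u uT; have [_ [r' [vr' hr']]] := hP v vT.
rewrite -E in hr'; have Er := linkage_inj Rd hr hr'; rewrite -Er in vr'.
exact: inj ur vr'.
Qed.

(** A separator below the minimum misses an entire band through each of [T1] and [T2], and
    robustness connects these bands around it. *)
Lemma cluster_linked T1 T2 : transversal T1 -> transversal T2 -> minn #|T1| #|T2| <= w ->
  disjoint_paths (induced G VCi) T1 T2 (minn #|T1| #|T2|).
Proof.
move=> t1 t2 le; set k := minn _ _ in le *.
have [|Q [Ql Qd]] := @menger _ (induced_adj G VCi) T1 T2 k.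
  move=> X sX; rewrite leqNgt; apply/negP => lt.
  have [r [u [uT rS ub rX]]] : exists r v, [/\ v \in T1, r \in RS i, in_band R (F i) (F i.+1) r v &
      forall x, in_band R (F i) (F i.+1) r x -> x \notin X].
    by apply: transversal_escape t1 (leq_trans lt (geq_minl _ _)).
  have [r' [v [vT rS' vb rX']]] : exists r v, [/\ v \in T2, r \in RS i, in_band R (F i) (F i.+1) r v &
      forall x, in_band R (F i) (F i.+1) r x -> x \notin X].
    by apply: transversal_escape t2 (leq_trans lt (geq_minr _ _)).
  have := forall_inP (forall_inP sX u _) v; rewrite !inE uT vT rX // rX' // => /(_ isT isT) /negP.
  apply; exact: (cluster_robust (cl iD) (leq_trans lt le)) rX rX' _ _ ub vb.
exists Q; split=> // k'; have := Ql k'; case: (Q k') => // x t.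
case/andP=> xt /and5P[ux xT lT _ _]; apply/and5P; split=> //.
have xV := subsetP (transversal_sub t1) x xT.
by rewrite inE xV (subsetP cluster_verts).
Qed.

Lemma cluster_connected : connected (induced G VCi).
Proof.
split.
  have : 0 < #|RS i| by apply: leq_trans (cluster_card (cl iD)); rewrite muln_gt0.
  case/card_gt0P => r rS; apply/set0Pn; have lt := cluster_gap (cl iD) rS.
  have sz := Fvalid (ltnW (ltn_ord i)) r.
  have [x xR] : exists x, x \in R r by case: (R r) sz => // x t _; exists x; rewrite mem_head.
  have vR : nth x (R r) (F i r) \in R r by rewrite mem_nth.
  exists (nth x (R r) (F i r)); rewrite inE (linkage_verts vR) /=.
  apply: (cluster_strand (cl iD)) rS _ _; rewrite /in_band vR index_uniq ?(linkage_uniq Rp) //.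
  by rewrite leqnn ltnW.
have csym : connect_sym (induced_adj G VCi) by apply/sym_connect_sym/induced_sym.
move=> u v; rewrite !inE => /andP[_ uV] /andP[_ vV].
have [r [x [rS xb ux]]] := cluster_reach (cl iD) uV.
have [r' [y [rS' yb vy]]] := cluster_reach (cl iD) vV.
apply: connect_trans ux _; rewrite csym; apply: connect_trans vy _; rewrite csym.
apply: sub_connect0; apply: (cluster_robust (cl iD)) rS rS' _ _ _ _ xb yb; rewrite ?cards0 //.
  by move=> *; rewrite inE.
by move=> *; rewrite inE.
Qed.
End OneCluster.

Lemma region_upper (i j : 'I_M) v r : j \in D -> i < j -> v \in region i j -> v \in R r ->
  index v (R r) < F j r \/ index v (R r) = F j r /\ (F j r).+1 < F j.+1 r.
Proof.
move=> jD ij; rewrite !inE -orbA => /or3P[/exists_inP[q _]|/existsP[q]|/exists_inP[q qS]].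
- move=> /andP[vq /eqP E] vR; rewrite (linkage_inj Rd vq vR) in E.
  by left; rewrite E; apply: Fmono; rewrite ij ltnW.
- by case/andP=> vq /andP[_ E] vR; rewrite (linkage_inj Rd vq vR) in E; left.
- move=> /andP[vq /eqP E] vR; rewrite (linkage_inj Rd vq vR) in E qS.
  by right; split=> //; apply: (cluster_gap (cl jD)).
Qed.

Lemma region_lower (i j : 'I_M) v r : i \in D -> i < j -> v \in region i j -> v \in R r ->
  F i r < index v (R r) \/ F i.+1 r <= index v (R r).
Proof.
move=> iD ij; rewrite !inE -orbA => /or3P[/exists_inP[q qS]|/existsP[q]|/exists_inP[q _]].
- move=> /andP[vq /eqP E] vR; rewrite (linkage_inj Rd vq vR) in E qS.
  by left; have := cluster_gap (cl iD) qS; rewrite -E ltnS.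
- by case/andP=> vq /andP[E _] vR; rewrite (linkage_inj Rd vq vR) in E; right.
- move=> /andP[vq /eqP E] vR; rewrite (linkage_inj Rd vq vR) in E.
  by right; rewrite E; apply: Fmono; rewrite ij ltnW.
Qed.

Lemma region_row (i j : nat) v : v \in region i j -> exists r, v \in R r.
Proof.
rewrite !inE -orbA => /or3P[/exists_inP[q _]|/existsP[q]|/exists_inP[q _]] /andP[vq _];
by exists q.
Qed.

(** The delicate case is [j = i']: the first region contains entries of that cluster and the second
    its exits, which [cluster_gap] keeps apart. *)
Lemma region_disjoint (i j i' j' : 'I_M) v : j \in D -> i' \in D -> i < j -> j <= i' -> i' < j' ->
  v \in region i j -> v \in region i' j' -> False.
Proof.
move=> jD iD' ij ji' ij' v1 v2; have [r vR] := region_row v1.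
have h1 : F j r <= F i' r by apply: Fmono; rewrite ji' ltnW.
have h2 : F j.+1 r <= F i'.+1 r by apply: Fmono; rewrite ltnS ji' ltn_ord.
have h3 : F i' r <= F i'.+1 r by apply: Fmono; rewrite leqnSn ltn_ord.
have := region_upper jD ij v1 vR; have := region_lower iD' ij' v2 vR.
by move: h1 h2 h3; clear; lia.
Qed.

Lemma between_cluster (i j k : 'I_M) v : k \in D -> (k <= i) || (j <= k) ->
  v \in between R F i j -> v \in VC k -> False.
Proof.
move=> kD h; rewrite inE => /existsP[r /andP[vr /andP[lo up]]] vV.
have [q /andP[vq]] := cluster_band (cl kD) vV; rewrite (linkage_inj Rd vq vr) => /andP[lo' up'].
case/orP: h => h.
  have : F k.+1 r <= F i.+1 r by apply: Fmono; rewrite ltnS h ltn_ord.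
  by move: lo up up' lo'; clear; lia.
have : F j r <= F k r by apply: Fmono; rewrite h ltnW.
by move: lo up up' lo'; clear; lia.
Qed.

Lemma cluster_disjoint (i j : 'I_M) v : i \in D -> j \in D -> i < j -> v \in VC i -> v \in VC j -> False.
Proof.
move=> iD jD ij vi vj; have [r /andP[vr /andP[_ up]]] := cluster_band (cl iD) vi.
have [q /andP[vq]] := cluster_band (cl jD) vj; rewrite (linkage_inj Rd vq vr) => /andP[lo _].
have : F i.+1 r <= F j r by apply: Fmono; rewrite ij ltnW.
by move: lo up; clear; lia.
Qed.

Lemma link_region (i j : nat) (A B : {set V}) q : link (induced_adj G (region i j)) A B q ->
  A \subset region i j -> {in q, forall v, v \in region i j}.
Proof.
by case: q => // x t /and3P[xt _ /andP[xA _]] /subsetP AS; apply: path_induced (AS x xA) xt.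
Qed.

(** The first and the last cluster of the chain are given up: a cluster gets its [A] from the ends
    of the paths arriving from its predecessor and its [B] from the starts of those leaving for its
    successor. Hence cluster [t] of the system is cluster [t.+1] of the chain. *)
Lemma strong_pos_of_chain (c : seq 'I_M) L : size c = L.+2 -> all [in D] c ->
  sorted (fun i j : 'I_M => joined G R w F RS i j) c -> has_strong_pos G L w.
Proof.
move=> sc /allP cD so; have [i0 _] : exists i, i \in c by case: (c) sc => // i t _; exists i; rewrite mem_head.
pose sl a := nth i0 c a.
have slD a : a < L.+2 -> sl a \in D by move=> lt; apply: cD; rewrite mem_nth ?sc.
have slJ a : a < L.+1 -> joined G R w F RS (sl a) (sl a.+1).
  by move=> lt; move/(sortedP i0): so; apply; rewrite sc.
have sl_lt a b : a < b < L.+2 -> sl a < sl b.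
  elim: b => [|b IH] /andP[ab bL] //; have lt : sl b < sl b.+1 by have /andP[] := slJ b bL.
  move: ab; rewrite ltnS leq_eqVlt => /predU1P[-> //|ab].
  by apply: ltn_trans lt; apply: IH; rewrite ab ltnW.
have sl_le a b : a <= b < L.+2 -> sl a <= sl b.
  case/andP; rewrite leq_eqVlt => /predU1P[-> //|ab] bL.
  by apply/ltnW/sl_lt; rewrite ab.
have exQ (a : 'I_L.+1) := joined_paths (slJ a (ltn_ord a)).
have [Q0 Q0P] := fin_all_exists exQ.
pose Q a := Q0 (inord a).
have QP a : a < L.+1 -> (forall k, link (induced_adj G (region (sl a) (sl a.+1)))
    (exits (sl a)) (entries (sl a.+1)) (Q a k)) /\ (forall k k', k != k' -> [disjoint Q a k & Q a k']).
  by move=> lt; have := Q0P (inord a); rewrite inordK.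
have Qreg a k : a < L.+1 -> {in Q a k, forall v, v \in region (sl a) (sl a.+1)}.
  move=> lt; have [ql _] := QP a lt; apply: link_region (ql k) _.
  by apply: subset_trans (subsetUl _ _) (subsetUl _ _).
pose Aset a := [set v | [exists k, (v \in Q a k) && (v \in entries (sl a.+1))]].
pose Bset a := [set v | [exists k, (v \in Q a k) && (v \in exits (sl a))]].
have Qends a k : a < L.+1 -> exists x t, [/\ Q a k = x :: t,
    forall v, v \in Q a k -> v \in exits (sl a) -> v = x,
    forall v, v \in Q a k -> v \in entries (sl a.+1) -> v = last x t,
    x \in exits (sl a) & last x t \in entries (sl a.+1)].
  move=> lt; have [ql _] := QP a lt; have [x [t [[E _ xA lB] [n1 n2]]]] := linkP (ql k).
  exists x, t; split=> // v; rewrite E.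
    by rewrite inE => /predU1P[//|/n1 /negP].
  by rewrite lastI mem_rcons inE => /predU1P[//|/n2 /negP].
have cardW a (S : {set V}) : a < L.+1 -> (forall k, exists v, [/\ v \in Q a k, v \in S &
    forall u, u \in Q a k -> u \in S -> u = v]) ->
    #|[set v | [exists k, (v \in Q a k) && (v \in S)]]| = w.
  move=> lt /fin_all_exists[e eP]; have [_ qd] := QP a lt.
  rewrite -[RHS]card_ord -(@card_imset _ _ e) => [|k k' E]; last first.
    apply/eqP; apply: contraT => /qd d; have [ek _ _] := eP k; have [ek' _ _] := eP k'.
    by case: (disjointE d ek); rewrite E.
  congr #|pred_of_set _|; apply/setP => v; rewrite inE; apply/existsP/imsetP => [[k /andP[vk vS]]|[k _ ->]].
    by exists k => //; have [_ _ u] := eP k; apply: u.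
  by exists k; have [-> -> _] := eP k.
have cA a : a < L.+1 -> #|Aset a| = w.
  move=> lt; apply: cardW => // k; have [x [t [E _ h _ lB]]] := Qends a k lt.
  by exists (last x t); rewrite E mem_last -E.
have cB a : a < L.+1 -> #|Bset a| = w.
  move=> lt; apply: cardW => // k; have [x [t [E h _ xA _]]] := Qends a k lt.
  by exists x; rewrite E mem_head -E.
have subA a : Aset a \subset entries (sl a.+1).
  by apply/subsetP => v; rewrite inE => /existsP[k /andP[_ ->]].
have subB a : Bset a \subset exits (sl a).
  by apply/subsetP => v; rewrite inE => /existsP[k /andP[_ ->]].
have lift (t : 'I_L) : t.+1 < L.+2 by rewrite ltnS ltnW // ltnS.
have lift1 (t : 'I_L) : t.+1 < L.+1 by rewrite ltnS.
have lift0 (t : 'I_L) : t < L.+1 by rewrite ltnW // ltnS.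
exists (fun t => induced G (VC (sl t.+1))), (fun t => Aset t), (fun t => Bset t.+1), (fun t => Q t.+1).
have trA (t : 'I_L) (T : {set V}) : T \subset Aset t -> transversal (sl t.+1) T.
  by move=> TS; apply: entries_transversal; [apply: slD | apply: subset_trans TS (subA t)].
have trB (t : 'I_L) (T : {set V}) : T \subset Bset t.+1 -> transversal (sl t.+1) T.
  by move=> TS; apply: exits_transversal; [apply: slD | apply: subset_trans TS (subB _)].
have VCv (t : 'I_L) T : transversal (sl t.+1) T -> T \subset verts (induced G (VC (sl t.+1))).
  move=> tr; apply/subsetP => v vT; have vV := subsetP (transversal_sub (slD _ (lift t)) tr) v vT.
  by rewrite inE vV (subsetP (cluster_verts (slD _ (lift t)))).
have minA (t : 'I_L) (T : {set V}) n : T \subset Aset t -> minn #|T| n <= w.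
  by move=> TS; apply: leq_trans (geq_minl _ _) _; rewrite -(cA t) ?subset_leq_card ?lift0.
have minB (t : 'I_L) (T : {set V}) n : T \subset Bset t.+1 -> minn #|T| n <= w.
  by move=> TS; apply: leq_trans (geq_minl _ _) _; rewrite -(cB t.+1) ?subset_leq_card ?lift1.
split.
- by move=> t; split; [apply: subsetIl | move=> u v /and3P[]].
- by move=> t; apply/cluster_connected/slD/lift.
- move=> t t' nt; apply/pred0P => v; apply/negP; rewrite /= !inE => /andP[/andP[_ v1] /andP[_ v2]].
  have [lt|lt|E] := ltngtP t t'.
  + by apply: (cluster_disjoint _ _ _ v1 v2); rewrite ?slD ?lift // sl_lt // !ltnS lt ltnW.
  + by apply: (cluster_disjoint _ _ _ v2 v1); rewrite ?slD ?lift // sl_lt // !ltnS lt ltnW.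
  + by case/eqP: nt; apply: val_inj.
- by move=> t; apply/VCv/trA.
- by move=> t; apply/VCv/trB.
- move=> t; apply/pred0P => v; apply/negP => /andP[/(subsetP (subA t))]; rewrite inE.
  move=> /exists_inP[r rS /andP[vR /eqP iv]] /(subsetP (subB t.+1)); rewrite inE.
  move=> /exists_inP[r' rS' /andP[vR' /eqP iv']]; rewrite -(linkage_inj Rd vR vR') iv in iv'.
  by have := cluster_gap (cl (slD _ (lift t))) rS; rewrite -iv' ltnn.
- by move=> t; apply: cA.
- by move=> t; apply: cB.
- move=> t T1 T2 s1 s2 _; apply: (cluster_linked (slD _ (lift t)) (trA t _ s1) (trA t _ s2)).
  exact: minA s1.
- move=> t T1 T2 s1 s2 _; apply: (cluster_linked (slD _ (lift t)) (trB t _ s1) (trB t _ s2)).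
  exact: minB s1.
- move=> t T1 T2 s1 s2; apply: (cluster_linked (slD _ (lift t)) (trA t _ s1) (trB t _ s2)).
  exact: minA s1.
- move=> t t' tt k; have [ql _] := QP t.+1 (lift1 t).
  have [x [y [[E xy xA lB] _]]] := linkP (ql k).
  have xQ : x \in Q t.+1 k by rewrite E mem_head.
  have lQ : last x y \in Q t.+1 k by rewrite E mem_last.
  have [r xR] := region_row (Qreg _ k (lift1 t) x xQ).
  rewrite E /path_between; apply/and5P; split; first exact: linkage_verts xR.
  + by apply: sub_path xy => u v /and3P[].
  + by have := ql k; rewrite E => /and3P[].
  + by rewrite inE; apply/existsP; exists k; rewrite xQ.
  + by rewrite inE tt; apply/existsP; exists k; rewrite lQ.
- move=> t t' k k' tL tL' nk; apply: disjointI => v v1 v2.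
  have [lt|lt|/val_inj E] := ltngtP t t'.
  + apply: (region_disjoint _ _ _ _ _ (Qreg _ _ (lift1 t) _ v1) (Qreg _ _ (lift1 t') _ v2)).
    * by apply: slD; rewrite ltnS lift1.
    * exact/slD/lift.
    * by apply: sl_lt; rewrite ltnSn ltnS lift1.
    * by apply: sl_le; rewrite ltnS lt lift.
    * by apply: sl_lt; rewrite ltnSn ltnS lift1.
  + apply: (region_disjoint _ _ _ _ _ (Qreg _ _ (lift1 t') _ v2) (Qreg _ _ (lift1 t) _ v1)).
    * by apply: slD; rewrite ltnS lift1.
    * exact/slD/lift.
    * by apply: sl_lt; rewrite ltnSn ltnS lift1.
    * by apply: sl_le; rewrite ltnS lt lift.
    * by apply: sl_lt; rewrite ltnSn ltnS lift1.
  + have [_ qd] := QP t.+1 (lift1 t); rewrite -E in v2 nk.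
    have nkk : k != k' by apply: contraNneq nk => ->.
    exact: disjointE (qd _ _ nkk) v1 v2.
- move=> t t' k tL; apply/pred0P => v; apply/negP => /andP[vi vc].
  have /setIP[_ vV] : v \in verts G :&: VC (sl t'.+1) := vc.
  have [ql _] := QP t.+1 (lift1 t); have [x [y [[E xy xA lB] [n1 n2]]]] := linkP (ql k).
  have [v1 v2] : v \in y /\ v \in belast x y.
    move: vi; rewrite /= E /=; case: (y) => [//|z y'] /= vb; split; last by rewrite inE vb orbT.
    exact: mem_belast.
  have : v \in region (sl t.+1) (sl t.+2) by apply: (Qreg _ k (lift1 t)); rewrite E inE v1 orbT.
  (* An inner vertex of a link is neither an exit nor an entry, so it lies strictly between two
     consecutive slots of the chain, where no cluster of the chain has vertices. *)
  rewrite !in_setU (negPf (n1 _ v1)) (negPf (n2 _ v2)) orbF /=.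
  move=> vb; apply: (between_cluster (slD _ (lift t')) _ vb vV).
  have [le|gt] := leqP t' t; apply/orP; [left|right].
    by apply: sl_le; rewrite ltnS le lift.
  by apply: sl_le; rewrite ltnS gt lift.
Qed.
End Assembly.

(** * Layers from the absence of a crossbar *)

Lemma layers_step (V : finType) (H : graph V) (A B X : {set V}) (kappa rho : nat)
    (P : 'I_kappa -> seq V) (S : {set 'I_kappa}) :
  [disjoint A & X] -> [disjoint B & X] -> (forall x, x \in X -> degree H x = 1) ->
  (forall i, path_between H A B (P i)) -> pairwise_disjoint P ->
  ~ has_crossbar H A B X rho ->
  exists (Z : {set 'I_kappa}) (Y : {set V}), [/\ Z \subset S, #|Z| + #|Y| <= rho &
    separates (adj H) [set v | [exists i in S, v \in P i]] X
      ([set v | [exists i in Z, v \in P i]] :|: Y)].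
Proof.
move=> dAX dBX deg Pp Pd nocross; set VS := [set v | [exists i in S, v \in P i]].
(* The ends of [P i] lie in [A] and [B], and an inner vertex would have two neighbours; so no vertex
   of [X] is on these paths, and a link to [X] has at least one step. *)
have PX x i : x \in P i -> x \in X -> False.
  move=> xP xX; have := Pp i; rewrite (path_betweenE x) => /and5P[_ _ so un /andP[hA lB]].
  case/splitPr: xP so un hA lB => s1 s2; case/lastP: s1 => [|s1 y] /=.
    by move=> _ _ xA _; rewrite (disjointFr dAX xA) in xX.
  rewrite last_cat /=; case: s2 => [|z s2] /=.
    by move=> _ _ _ xB; rewrite (disjointFr dBX xB) in xX.
  rewrite cat_rcons sorted_split => /andP[_ /and3P[yx xz _]] un _ _.
  have nyz : y != z.
    by apply: contraTneq un => ->; rewrite cat_uniq /= !inE eqxx !orbT !andbF.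
  have : 1 < degree H x.
    apply: (@leq_trans #|[set y; z]|); first by rewrite cards2 nyz.
    apply/subset_leq_card/subsetP => u; rewrite /degree.
    by rewrite !inE => /orP[] /eqP -> //; rewrite adj_sym.
  by rewrite deg.
have inVS i v : i \in S -> v \in P i -> v \in VS.
  by move=> iS vP; rewrite inE; apply/exists_inP; exists i.
(* [inr i] stands for the contracted path [P i]; walks leave it at once and never
   return to a path of [S], which makes them the paths [Q] of a crossbar. *)
pose e : rel (V + 'I_kappa) := fun a b => match a, b with
  | inl u, inl v => [&& u \notin VS, v \notin VS & adj H u v]
  | inr i, inl v => [&& i \in S, v \notin VS & [exists u in P i, adj H u v]]
  | _, inr _ => false
  end.
pose src : {set V + 'I_kappa} := [set inr i | i in S].
pose tgt : {set V + 'I_kappa} := [set inl x | x in X].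
have inl_path v t : path e (inl v) t -> exists t', [/\ t = map inl t', path (adj H) v t' &
    {in t', forall z, z \notin VS}].
  elim: t v => [|[z|//] t IH] v /=; first by exists [::].
  case/andP=> /and3P[_ zS vz] /IH[t' [-> tp tS]]; exists (z :: t'); split; rewrite //= ?vz //.
  by move=> q; rewrite inE => /predU1P[->|/tS].
have [kS|] := boolP [forall Y0 : {set V + 'I_kappa}, separates e src tgt Y0 ==> (rho <= #|Y0|)].
  case: nocross; have [|Q [Ql Qd]] := @menger _ e src tgt rho.
    by move=> Y0 sY; apply: (implyP (forallP kS Y0)).
  have ex k : exists a : 'I_kappa * (V * seq V), [/\ a.1 \in S, a.2.1 \in P a.1,
      path (adj H) a.2.1 a.2.2, uniq a.2.2 & last a.2.1 a.2.2 \in X] /\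
      (Q k = inr a.1 :: map inl a.2.2 /\ {in a.2.2, forall z, z \notin VS}).
    have [x [t [[E xt xs tl] _]]] := linkP (Ql k); have := Ql k; rewrite E => /and3P[_ un _].
    case/imsetP: xs => i iS xE; subst x; case: t xt tl un {E} (E : Q k = _) => [|[v|//] t] /=.
      by move=> _ /imsetP[].
    case/andP=> /and3P[_ vS /exists_inP[u uP uv]] /inl_path[t' [-> tp tS]].
    rewrite last_map => /imsetP[x xX [lx]] un E; exists (i, (u, v :: t')); split; last first.
      by split=> // q; rewrite inE => /predU1P[->|/tS].
    split; rewrite //= ?uv ?tp ?lx //.
    have inlI : injective (@inl V 'I_kappa) by move=> ? ? [].
    by move: un; rewrite (mem_map inlI) (map_inj_uniq inlI) => /and3P[_ -> ->].
  have [a aP] := fin_all_exists ex.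
  have a_inj k k' : (a k).1 = (a k').1 -> k = k'.
    move=> E; apply/eqP; apply: contraT => /Qd d; have [_ [Ek _]] := aP k; have [_ [Ek' _]] := aP k'.
    by case: (disjointE (v := inr (a k).1) d); rewrite ?Ek ?Ek' ?E mem_head.
  have Pdis k k' v : k != k' -> v \in P (a k).1 -> v \in P (a k').1 -> False.
    move=> nk; apply: disjointE; apply: Pd; apply: contraNneq nk => /a_inj ->; exact: eqxx.
  have nP k v i : v \in (a k).2.2 -> i \in S -> v \in P i -> False.
    by have [_ [_ nS]] := aP k; move=> /nS vS iS vP; rewrite (inVS i) in vS.
  exists (fun k => P (a k).1), (fun k => (a k).2.1 :: (a k).2.2); split.
  - by move=> k; apply: Pp.
  - move=> k; have [[iS uP tp un tl] [E nS]] := aP k; rewrite /path_between.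
    apply/and5P; split; rewrite ?inE //.
      have := Pp (a k).1; case: (P (a k).1) uP => // y s uP /and3P[yH ys _].
      elim: s y yH ys uP => [|z s IH] y yH /=; first by rewrite inE => _ /eqP ->.
      case/andP=> yz zs; rewrite inE => /predU1P[-> //|]; apply: IH zs.
      by move: yz; rewrite adj_sym => /adj_verts.
    rewrite /= un andbT; apply/negP => /nS; rewrite (inVS (a k).1) //.
  - by move=> k k' nk; apply: disjointI => v; apply: Pdis.
  - move=> k k' nk; apply: disjointI => v; rewrite !inE.
    have [[iS uP _ _ _] [E _]] := aP k; have [[iS' uP' _ _ _] [E' _]] := aP k'.
    case/predU1P=> [->|vt]; case/predU1P=> [vE|vt'].
    + by apply: Pdis nk uP _; rewrite vE.
    + exact: nP vt' iS uP.
    + by rewrite vE in vt; apply: nP vt iS' uP'.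
    + by apply: (disjointE (v := inl v) (Qd _ _ nk)); rewrite ?E ?E' inE map_f ?orbT.
  - move=> k k' nk; apply: disjointI => v vP; rewrite inE.
    have [[iS _ _ _ _] _] := aP k; have [[_ uP' _ _ _] _] := aP k'.
    case/predU1P=> [vE|vt]; last exact: nP vt iS vP.
    by rewrite vE in vP; apply: Pdis nk vP uP'.
  - move=> k; have [[iS uP _ _ _] _] := aP k; exists (a k).2.1; first by rewrite /= eqxx.
    apply/setP => v; rewrite !inE; apply/andP/eqP => [[vP]|->]; last by rewrite uP eqxx.
    by case/predU1P=> // vt; case: (nP k v _ vt iS vP).
rewrite negb_forall => /existsP[Y0]; rewrite negb_imply -ltnNge => /andP[sepY cY].
pose Z := [set i in S | inr i \in Y0]; pose Y := [set v | inl v \in Y0].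
exists Z, Y; split; first by apply/subsetP => i; rewrite inE => /andP[].
  apply: leq_trans (ltnW cY); rewrite -(@card_imset _ _ (@inr V 'I_kappa) Z) => [|? ? []//].
  rewrite -(@card_imset _ _ (@inl V 'I_kappa) Y) => [|? ? []//].
  rewrite -cardsUI (_ : _ :&: _ = set0) ?cards0 ?addn0.
    apply/subset_leq_card/subsetP => q /setUP[] /imsetP[q' q'S ->]; move: q'S; rewrite inE //.
    by case/andP.
  by apply/setP => q; rewrite !inE; apply/negP => /andP[/imsetP[i _ ->] /imsetP[]].
apply/separatesP => x s xV xs sX.
(* Cut at its last vertex on a path of [S], a walk of [H] becomes a walk of [e], so [Y0] blocks
   it. *)
have [|x' [s' [x'V s'p s'l s'n sub]]] := @trim_source _ (adj H) VS x s xs; first by rewrite xV.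
have /exists_inP[i iS x'P] : [exists i in S, x' \in P i] by move: x'V; rewrite inE.
have /hasP[q qs qY] : has [in Y0] (inr i :: map inl s').
  apply: (separatesP _ _ _ _ sepY); first exact: imset_f.
    case: s' s'p s'n {s'l sub} => //= v s' /andP[x'v vs'] /andP[vS s'S]; rewrite iS vS /=.
    apply/andP; split; first by apply/exists_inP; exists x'.
    elim: s' v vS vs' s'S {x'v} => //= z s' IH v vS /andP[vz zs'] /andP[zS s'S].
    by apply/andP; split; [apply/and3P | apply: IH].
  case: s' s'p s'l {s'n sub} => [_ E|v s' _ E] /=.
    by case: (PX x' i x'P); rewrite -E in sX.
  by rewrite last_map; apply: imset_f; rewrite -[last v s']/(last x' (v :: s')) E.
apply/(@hasP _ [in _ :|: Y] (x :: s)); move: qs; rewrite inE => /predU1P[qE|/mapP[v vs' qE]].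
  exists x'; first by apply: sub; rewrite mem_head.
  rewrite !inE; apply/orP; left; apply/exists_inP; exists i => //.
  by rewrite inE iS -qE.
exists v; first by apply: sub; rewrite inE vs' orbT.
by rewrite !inE -qE qY orbT.
Qed.

(** * From instances to the system, and the choice of parameters *)

Lemma first_in_unique (V : finType) (p m M : nat) (R : 'I_p -> seq V) (P : 'I_m -> seq V)
    (F : nat -> 'I_p -> nat) (i i' : 'I_M) j :
  pairwise_disjoint R -> (forall k k', k <= k' <= M -> forall r, F k r <= F k' r) ->
  first_in R P (F i) (F i.+1) j -> first_in R P (F i') (F i'.+1) j -> i = i'.
Proof.
move=> Rd Fmono /existsP[v /and3P[vP /eqP v0 /existsP[r /andP[vr /andP[lo hi]]]]].
case/existsP=> v' /and3P[vP' /eqP v0' /existsP[r' /andP[vr' /andP[lo' hi']]]].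
have E : v' = v by rewrite -(nth_index v vP) v0 -v0' nth_index.
subst v'; have E := linkage_inj Rd vr vr'; subst r'.
apply: val_inj; case: (ltngtP i i') => //= lt.
  have le : F i.+1 r <= F i' r by apply: Fmono; rewrite lt ltnW.
  by have := ltn_trans (leq_trans hi le) lo'; rewrite ltnn.
have le : F i'.+1 r <= F i r by apply: Fmono; rewrite lt ltnW.
by have := ltn_trans (leq_trans hi' le) lo; rewrite ltnn.
Qed.

(** Parameters: there are [2 * h] slots with [E] new pairs each; at most [N] paths start in a slot
    used for a cluster; at least [h] clusters result; among any [n] of them two are joined; the
    chain needs [L.+2] of them. *)
Lemma instance_strong_pos (V : finType) (H G : graph V) (m p K rho : nat) (Z : nat -> {set 'I_m})
    (U W : {set V}) (P : 'I_m -> seq V) (Y : nat -> {set V}) (J : {set 'I_m})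
    (w s n N E h L : nat) :
  instance H p K rho Z G U W P Y ->
  (forall k, k < K -> Z k \subset J) ->
  (forall k k', k < k' < K -> [disjoint Z k & Z k']) ->
  #|J| <= N.+1 * h -> 2 * h * E + p <= K * (p - rho) ->
  p + (2 * s * (N + 2 * p) + 4 * w * p) <= E ->
  0 < w -> 2 * w <= s -> s <= p -> 0 < n -> 2 * p <= s * n -> 2 * w * w * n < s * s ->
  L.+2 * n <= h ->
  exists G' : graph V, minor G' H /\ has_strong_pos G' L w.
Proof.
move=> /minimal_instance[G1 [U1 [W1 [P1 [Y1 [inst mini]]]]]] ZJ Zd cJ hE hN w0 ws sp n0 pn wn Ln.
exists G1; split; first exact: inst_minor inst.
have [R [Rp Rd]] := inst_link inst.
have Redge r a b := min_link_edge inst mini Rp Rd (r := r) (a := a) (b := b).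
have PR j a b := min_on_link inst mini Rp Rd (j := j) (a := a) (b := b).
have cH : 2 * h * E <= #|hits_before R P1 J (last_frontier R)|.
  rewrite -(leq_add2r p); apply: leq_trans hE _.
  apply: leq_trans (hits_total_layers Rp Rd (inst_sep inst) (inst_card inst) ZJ Zd) _.
  exact: hits_before_last (inst_disj inst).
have [F HF] := frontier_sequence Rp Rd Redge (inst_disj inst) cH.
have Fvalid i : i <= 2 * h -> valid R (F i) by case/HF.
have Fmono i i' : i <= i' <= 2 * h -> forall r, F i r <= F i' r.
  by move=> /andP[ii' i'M] r; have [_ _ _] := HF i (leq_trans ii' i'M); apply; rewrite ii'.
pose firsts (i : 'I_(2 * h)) := [set j in J | first_in R P1 (F i) (F i.+1) j].
pose D := [set i | #|firsts i| <= N].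
(* A path starts inside at most one slot, so at most [h] slots contain more than [N] starts. *)
have cD : h <= #|D|.
  have : N.+1 * #|~: D| <= N.+1 * h.
    apply: leq_trans cJ; rewrite mulnC -sum_nat_const.
    apply: (@leq_trans (\sum_(i in ~: D) #|firsts i|)).
      by apply: leq_sum => i; rewrite !inE -ltnNge.
    apply: sum_card_disjoint => [i _|i i' j _ _]; first by apply/subsetP => j; rewrite inE => /andP[].
    by rewrite !inE => /andP[_ a] /andP[_ b]; apply: first_in_unique Rd Fmono a b.
  have := cardsC D; rewrite card_ord leq_mul2l /=; clear; lia.
have ex (i : 'I_(2 * h)) : exists S : {set 'I_p} * {set V},
    i \in D -> cluster G1 R w s (F i) (F i.+1) S.1 S.2.
  have [iD|] := boolP (i \in D); last by exists (set0, set0).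
  have [vf sf ci _] := HF i (ltnW (ltn_ord i)); have [vf' sf' ci' _] := HF i.+1 (ltn_ord i).
  have [] := @slot_cluster _ _ _ _ _ _ Rp Rd _ _ J (inst_sorted inst) (inst_uniq inst)
    (inst_disj inst) PR _ _ vf vf' sf sf' w s N w0 ws sp.
  - by move: iD; rewrite inE.
  - by rewrite ci ci' (mulSn i E) [E + _]addnC -addnA leq_add2l.
  by move=> RS [VC cl]; exists (RS, VC).
have [S SP] := fin_all_exists ex.
pose RS k := if insub k is Some i then (S i).1 else set0.
pose VC k := if insub k is Some i then (S i).2 else set0.
have cl (i : 'I_(2 * h)) : i \in D -> cluster G1 R w s (F i) (F i.+1) (RS i) (VC i).
  by move=> iD; rewrite /RS /VC valK; apply: SP.
have [|c [sc cD' so]] := @chain_of_dense _ D (fun i j => joined G1 R w F RS i j) n L.+1 n0 _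
    (leq_trans Ln cD).
  move=> B BD cB; apply: NNPP => none.
  apply: (unjoined_card Rp Rd Fvalid Fmono cl BD); rewrite ?cB //.
  by move=> i j iB jB; apply/negP => ij; apply: none; exists i, j.
have s0 : 0 < s by apply: leq_trans ws; rewrite muln_gt0.
exact (strong_pos_of_chain Rp Rd Fvalid Fmono cl w0 s0 sc cD' so).
Qed.

Lemma layered_instance (V : finType) (H : graph V) (A B X : {set V}) (kappa K rho p : nat) :
  [disjoint A & X] -> [disjoint B & X] -> (forall x, x \in X -> degree H x = 1) -> #|A| = kappa ->
  disjoint_paths H A B kappa -> disjoint_paths H A X kappa -> ~ has_crossbar H A B X rho ->
  K * rho + p <= kappa ->
  exists (Z : nat -> {set 'I_kappa}) (J : {set 'I_kappa}) (U : {set V}) (P : 'I_kappa -> seq V)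
    (Y : nat -> {set V}), instance H p K rho Z H U X P Y /\ 
    [/\ forall k, k < K -> Z k \subset J,
        forall k k', k < k' < K -> [disjoint Z k & Z k'] & #|J| <= K * rho].
Proof.
move=> dAX dBX deg cA [P [Pp Pd]] [Q [Qp Qd]] nocross hK.
have ex (S : {set 'I_kappa}) : exists ZY : {set 'I_kappa} * {set V},
    [/\ ZY.1 \subset S, #|ZY.1| + #|ZY.2| <= rho &
    separates (adj H) [set v | [exists i in S, v \in P i]] X
      ([set v | [exists i in ZY.1, v \in P i]] :|: ZY.2)].
  by have [Z [Y ZY]] := layers_step S dAX dBX deg Pp Pd nocross; exists (Z, Y).
have [f fP] := fin_all_exists ex.
pose S k := iter k (fun S => S :\: (f S).1) setT; pose Z k := (f (S k)).1.
have Santi k k' : k <= k' -> S k' \subset S k.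
  move=> /subnKC <-; elim: (k' - k) => [|d IH]; first by rewrite addn0.
  by rewrite addnS; apply: subset_trans IH; apply: subsetDl.
have ZS k : Z k \subset S k by have [] := fP (S k).
have notS k k' i : k < k' -> i \in Z k -> i \notin S k'.
  move=> kk' iZ; apply/negP => /(subsetP (Santi _ _ kk')).
  by rewrite /S iterS -/(S k) inE -/(Z k) iZ.
have cS k : #|~: S k| <= k * rho.
  elim: k => [|k IH]; first by rewrite /S /= setCT cards0.
  rewrite /S iterS -/(S k) setCD mulSn addnC; apply: leq_trans (leq_card_setU _ _) _.
  by apply: leq_add => //; have [_ c _] := fP (S k); apply: leq_trans c; apply: leq_addr.
have [I IS cI] : exists2 I : {set 'I_kappa}, I \subset S K & #|I| = p.
  apply: subset_of_card; have := cardsC (S K); have := cS K; rewrite card_ord; move: hK; clear; lia.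
have exh i : exists x, (x \in A) && (x \in P i).
  have := Pp i; case: (P i) => // x t /and5P[_ _ _ xA _]; exists x.
  by rewrite xA mem_head.
have [hd hdP] := fin_all_exists exh.
have exq i : exists x, (x \in A) && (x \in Q i) && (head x (Q i) == x).
  by have := Qp i; case: (Q i) => // x t /and5P[_ _ _ xA _]; exists x; rewrite xA mem_head /=.
have [q qP] := fin_all_exists exq.
have qinj : injective q.
  move=> i j E; apply/eqP; apply: contraT => /Qd d; have /andP[/andP[_ qi] _] := qP i.
  by have /andP[/andP[_ qj] _] := qP j; case: (disjointE d qi); rewrite E.
(* The [kappa] disjoint paths [Q j] start at distinct vertices of [A], hence at all of them; those
   starting in [U] are the strands. *)
have exs i : exists j, q j = hd i.
  apply: (surj_count qinj _ cA) => [j|]; first by have /andP[/andP[]] := qP j.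
  by have /andP[] := hdP i.
have [t tP] := fin_all_exists exs.
have hd_inj : injective hd.
  move=> i j E; apply/eqP; apply: contraT => /Pd d; have /andP[_ hi] := hdP i.
  by have /andP[_ hj] := hdP j; case: (disjointE d hi); rewrite E.
exists Z, (~: S K), (hd @: I), P, (fun k => (f (S k)).2); split; last first.
  split=> [k kK|k k' /andP[kk' k'K]|]; last exact: cS.
    by apply/subsetP => i iZ; rewrite inE (notS k).
  rewrite disjoint_subset; apply/subsetP => i iZ; rewrite inE; apply/negP => /(subsetP (ZS k')).
  by apply/negP; apply: notS iZ.
split.
- exact: minor_refl.
- subst p; exists (fun r => Q (t (enum_val r))); split=> [r|r r' nr].
    have /andP[/andP[qA qQ] qh] := qP (t (enum_val r)).
    have := Qp (t (enum_val r)); move: qh qQ; rewrite tP.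
    case: (Q _) => // x s /= /eqP -> _ /and5P[xH xs un _ lX].
    by apply/and5P; split=> //; apply/imset_f/enum_valP.
  apply: Qd; apply: contraNneq nr => /(congr1 q); rewrite !tP => /hd_inj /enum_val_inj ->.
  exact: eqxx.
- by move=> j; have := Pp j; case: (P j) => // x s /and5P[].
- by move=> j; have := Pp j; case: (P j) => // x s /and5P[].
- by move=> i j; apply: Pd.
- move=> k kK; apply/separatesP => x s /imsetP[i iI ->] xs sX.
  have [_ _ sep] := fP (S k); apply: (separatesP _ _ _ _ sep _ _ _ xs sX).
  rewrite inE; apply/exists_inP; exists i.
    exact: (subsetP (Santi _ _ (ltnW kK))) (subsetP IS _ iI).
  by have /andP[] := hdP i.
- by move=> k kK; have [_ c _] := fP (S k); apply: leq_trans c; apply: leq_addl.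
Qed.

(** Here [w = rho = g ^ 2]. With [s = 9 * g ^ 3] and [n = 32 * g ^ 2], [2 * w * w * n < s * s] reads
    [64 * g ^ 6 < 81 * g ^ 6], and [p = 144 * g ^ 5] gives [2 * p = s * n]. [h = 2 ^ 6 * g ^ 4] is
    at least [(g ^ 2 + 2) * n], and [N] satisfies [N * h = K * rho]. The main term of [2 * h * E] is
    then [4 * s * rho * K = 36 * g ^ 5 * K], a quarter of [K * p], and [K = 2 ^ 18 * g ^ 7] is large
    enough to absorb the other terms. *)
Lemma strong_pos_or_crossbar (V : finType) (H : graph V) (A B X : {set V}) (kappa g : nat) :
  1 < g -> [disjoint A & X] -> [disjoint B & X] -> (forall x, x \in X -> degree H x = 1) ->
  #|A| = kappa -> disjoint_paths H A B kappa -> disjoint_paths H A X kappa ->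
  2 ^ 22 * g ^ 9 <= kappa -> ~ has_crossbar H A B X (g ^ 2) ->
  exists G : graph V, minor G H /\ has_strong_pos G (g ^ 2) (g ^ 2).
Proof.
move=> g1 dAX dBX deg cA AB AX hk nocross.
have g0 : 0 < g by apply: ltnW.
have pw a b : a <= b -> g ^ a <= g ^ b by apply: leq_pexp2l.
have [|Z [J [U [P [Y [inst [ZJ Zd cJ]]]]]]] :=
    @layered_instance V H A B X kappa (2 ^ 18 * g ^ 7) (g ^ 2) (144 * g ^ 5)
      dAX dBX deg cA AB AX nocross.
  by apply: leq_trans hk; have := pw 5 9 isT; clear; lia.
pose N := 2 ^ 12 * g ^ 5.
pose E := 144 * g ^ 5 + (2 * (9 * g ^ 3) * (N + 2 * (144 * g ^ 5)) + 4 * g ^ 2 * (144 * g ^ 5)).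
apply: (instance_strong_pos (s := 9 * g ^ 3) (n := 32 * g ^ 2) (N := N) (E := E) (h := 2 ^ 6 * g ^ 4)
  inst ZJ Zd).
- by apply: leq_trans cJ _; rewrite /N; clear; lia.
- rewrite mulnBr -[X in X <= _](addnK (2 ^ 18 * g ^ 7 * g ^ 2)); apply: leq_sub2r.
  have -> : 2 * (2 ^ 6 * g ^ 4) * E =
      144 * 2 ^ 7 * g ^ 9 + 18 * 2 ^ 7 * (2 ^ 12 + 288) * g ^ 12 + 2 ^ 7 * 576 * g ^ 11.
    by rewrite /E /N; clear; lia.
  have -> : 2 ^ 18 * g ^ 7 * (144 * g ^ 5) = 2 ^ 18 * 144 * g ^ 12 by clear; lia.
  have -> : 2 ^ 18 * g ^ 7 * g ^ 2 = 2 ^ 18 * g ^ 9 by clear; lia.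
  by have := pw 5 12 isT; have := pw 9 12 isT; have := pw 11 12 isT; clear; lia.
- exact: leqnn.
- by rewrite expn_gt0 g0.
- by have := pw 2 3 isT; clear; lia.
- by have := pw 3 5 isT; clear; lia.
- by rewrite muln_gt0 expn_gt0 g0.
- by clear; lia.
- by have : 0 < g ^ 6 by [rewrite expn_gt0 g0]; clear; lia.
- have : 2 * g ^ 2 <= g ^ 4 by rewrite (expnD g 2 2) leq_mul2r (leq_trans g1 (pw 1 2 isT)) orbT.
  by clear; lia.
Qed.

Import Order.TTheory GRing.Theory Num.Theory.
Local Open Scope ring_scope.

Lemma log2_ge1 (R : realType) (g : nat) : (1 < g)%N -> 1 <= log2 (g%:R : R).
Proof.
move=> g1; rewrite /log2 ler_pdivlMr ?ln_gt0 ?ltr1n // mul1r.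
by rewrite ler_ln ?posrE ?ltr0n ?ler_nat // ltnW.
Qed.

Theorem theorem3p2 (R : realType) :
  exists c : R, 0 < c /\
    forall (V : finType) (H : graph V) (g kappa : nat) (A B X : {set V}),
      (2 <= g)%N ->
      (exists k : nat, g = (2 ^ k)%N) ->
      A \subset verts H -> B \subset verts H -> X \subset verts H ->
      [disjoint A & B] -> [disjoint A & X] -> [disjoint B & X] ->
      #|A| = kappa -> #|B| = kappa -> #|X| = kappa ->
      2 ^+ 22 * g%:R ^+ 9 * log2 (g%:R : R) <= kappa%:R ->
      (forall x, x \in X -> degree H x = 1%N) ->
      disjoint_paths H A B kappa ->
      disjoint_paths H A X kappa ->
      has_crossbar H A B X (g ^ 2)
      \/ exists (U : finType) (H' : graph U) (l w : nat),
           [/\ minor H' H, has_strong_pos H' l w,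
               c * g%:R ^+ 2 <= l%:R & c * g%:R ^+ 2 <= w%:R].
Proof.
exists 1; split=> // V H g kappa A B X g1 _ AH BH XH _ dAX dBX cA _ _ hk deg AB AX.
have [cross|nocross] := classic (has_crossbar H A B X (g ^ 2)); [by left | right].
have hk' : (2 ^ 22 * g ^ 9 <= kappa)%N.
  rewrite -(ler_nat R) natrM !natrX; apply: le_trans hk; rewrite ler_peMr ?log2_ge1 //.
  by rewrite mulr_ge0 ?exprn_ge0.
have [G [GH pos]] := strong_pos_or_crossbar g1 dAX dBX deg cA AB AX hk' nocross.
by exists V, G, (g ^ 2)%N, (g ^ 2)%N; split; rewrite // mul1r natrX.
Qed.
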